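(* Let $\mathbf s=(\sigma_1,\dots,\sigma_p)$ be a reduced tuple of elements of $\mathcal S$ and let $w=\sigma_1\cdots\sigma_p$. Then \[ \{x\in WH_b\mid x\le w\}=\{\pi_{\mathbf s}(\mathbf x)\mid \mathbf x\in\mathcal D_{\mathbf s}\}, \] where $\mathcal D_{\mathbf s}$ is the set of distinguished subexpressions of $\mathbf s$ and $\pi_{\mathbf s}(x_0,\dots,x_p)=x_p$.
   Context: Let $q$ be a prime power, $n\ge1$, and $a,b$ relatively prime positive integers with $ab=q-1$. Let $F_b$ be the subgroup of order $b$ of $\mathbb F_q^\times$, $H_b$ the group of diagonal matrices in $\mathrm{GL}_n(\mathbb F_q)$ with entries in $F_b$, and $W\subset\mathrm{GL}_n(\mathbb F_q)$ the group of permutation matrices, so $WH_b$ is a subgroup isomorphic to $G(b,1,n)$. $\mathcal S=\{s_1,\dots,s_{n-1}\}$, where $s_i$ is the permutation matrix of $(i,i+1)$; $\ell$ is the length function of $(W,\mathcal S)$, extended to $WH_b$ by $\ell(wd)=\ell(dw)=\ell(w)$ for $w\in W$, $d\in H_b$. For $\alpha\in F_b$, $h_i(\alpha)$ is the diagonal matrix with $i$-th diagonal entry $\alpha$ and other diagonal entries $1$; $h_{i,j}(\alpha)=h_i(\alpha)h_j((-1)^{b-1}\alpha^{-1})$ for $i\ne j$; and $X_{s_i}=\{h_{i,i+1}(\alpha)\mid\alpha\in F_b\}$. Let $A=\mathbb Z[\mathbf a,\mathbf v]$ with $\mathbf a,\mathbf v$ indeterminates. $\mathcal H$ is the associative unital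 $A$-algebra with generators $\{t_s\mid s\in\mathcal S\}\cup\{t_d\mid d\in H_b\}$ and relations: $t_1=1_{\mathcal H}$; $t_dt_{d'}=t_{dd'}$; $t_dt_{s_i}=t_{s_i}t_{s_ids_i}$; $t_{s_i}t_{s_j}=t_{s_j}t_{s_i}$ if $|j-i|>1$; $t_{s_i}t_{s_{i+1}}t_{s_i}=t_{s_{i+1}}t_{s_i}t_{s_{i+1}}$; $t_{s_i}^2=\mathbf v^2 1_{\mathcal H}+\mathbf a\sum_{d\in X_{s_i}}t_dt_{s_i}$. For $x=wd$ with $w=s_{i_1}\cdots s_{i_p}\in W$ reduced and $d\in H_b$, $t_x=t_{s_{i_1}}\cdots t_{s_{i_p}}t_d$ (well defined); $\{t_x\}_{x\in WH_b}$ is an $A$-basis of $\mathcal H$. Let $A_{\mathbf v}=\mathbb Z[\mathbf a,\mathbf v,\mathbf v^{-1}]$, $\mathcal H_{\mathbf v}=A_{\mathbf v}\otimes_A\mathcal H$ and $T_x=\mathbf v^{-\ell(x)}\otimes t_x$, so $\{T_x\}_{x\in WH_b}$ is an $A_{\mathbf v}$-basis of $\mathcal H_{\mathbf v}$. Each $T_x$ is a unit. The bar involution: $\overline{\phantom{x}}\colon A_{\mathbf v}\to A_{\mathbf v}$ is the ring endomorphism with $\overline{\mathbf v}=\mathbf v^{-1}$, $\overline{\mathbf a}=-\mathbf a\mathbf v^{-2}$; it extends to $\mathcal H_{\mathbf v}$ by $\overline{\sum_x\gamma_xT_x}=\sum_x\overline{\gamma_x}\,\overline{T_x}$ with $\overline{T_x}=T_{x^{-1}}^{-1}$.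 Elements $R^*_{x,y}\in A_{\mathbf v}$ are defined by $\overline{T_y}=\sum_{x\in WH_b}\overline{R^*_{x,y}}\,T_x$, and $x\le y$ means $R^*_{x,y}\ne0$ (this is a partial order on $WH_b$). A tuple $(\sigma_1,\dots,\sigma_p)$ of elements of $\mathcal S$ is reduced if $\ell(\sigma_1\cdots\sigma_p)=p$. A distinguished subexpression of a reduced tuple $\mathbf s=(\sigma_1,\dots,\sigma_p)$ is a $(p+1)$-tuple $\mathbf x=(x_0,x_1,\dots,x_p)$ of elements of $WH_b$ such that $x_0=1$ and, for $1\le j\le p$, $x_{j-1}^{-1}x_j\in\{\sigma_j\}\cup X_{\sigma_j}$ and $x_j\le x_{j-1}\sigma_j$. *)

(* Defs.v *)
From HB Require Import structures.
From mathcomp Require Import all_boot all_order all_algebra all_fingroup.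
From mathcomp Require Import generic_quotient fraction.
From mathcomp Require Import boolp classical_sets.

Set Implicit Arguments.
Unset Strict Implicit.
Unset Printing Implicit Defensive.

Import GRing.Theory.
Local Open Scope ring_scope.
Local Open Scope quotient_scope.

(* Associative unital algebras over a commutative ring [R] presented by a type
   [X] of generators and a relation [r] on noncommutative polynomial
   expressions: expressions modulo the least congruence that contains [r] and
   the axioms of R-algebras. *)

Inductive pterm (R X : Type) : Type :=
| PGen of X
| PCst of R
| PAdd of pterm R X & pterm R X
| PMul of pterm R X & pterm R X.

Arguments PGen {R X}.
Arguments PCst {R X}.

HB.instance Definition _ (R X : Type) := gen_eqMixin (pterm R X).
HB.instance Definition _ (R X : Type) := gen_choiceMixin (pterm R X).

Declare Scope pterm_scope.
Delimit Scope pterm_scope with P.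
Bind Scope pterm_scope with pterm.
Notation "u + v" := (PAdd u v) : pterm_scope.
Notation "u * v" := (PMul u v) : pterm_scope.

Inductive pcong (R : comNzRingType) (X : Type)
    (r : pterm R X -> pterm R X -> Prop) : pterm R X -> pterm R X -> Prop :=
| pcong_rel u v : r u v -> pcong r u v
| pcong_refl u : pcong r u u
| pcong_sym u v : pcong r u v -> pcong r v u
| pcong_trans u v w : pcong r u v -> pcong r v w -> pcong r u w
| pcong_add u u' v v' : pcong r u u' -> pcong r v v' -> pcong r (u + v) (u' + v')
| pcong_mul u u' v v' : pcong r u u' -> pcong r v v' -> pcong r (u * v) (u' * v')
| pcong_addA u v w : pcong r (u + (v + w)) (u + v + w)
| pcong_addC u v : pcong r (u + v) (v + u)
| pcong_add0 u : pcong r (PCst 0 + u) u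
| pcong_addN u : pcong r (PCst (-1) * u + u) (PCst 0)
| pcong_mulA u v w : pcong r (u * (v * w)) (u * v * w)
| pcong_mul1l u : pcong r (PCst 1 * u) u
| pcong_mul1r u : pcong r (u * PCst 1) u
| pcong_mulDl u v w : pcong r ((u + v) * w) (u * w + v * w)
| pcong_mulDr u v w : pcong r (u * (v + w)) (u * v + u * w)
| pcong_cstD c d : pcong r (PCst (c + d)%R) (PCst c + PCst d)
| pcong_cstM c d : pcong r (PCst (c * d)%R) (PCst c * PCst d)
| pcong_cstC c u : pcong r (PCst c * u) (u * PCst c).

Section PresentedAlgebra.
Variables (R : comNzRingType) (X : Type).
Variable r : pterm R X -> pterm R X -> Prop.

Definition pcongb : rel (pterm R X) := fun u v => `[< pcong r u v >].

Lemma pcongb_refl : reflexive pcongb.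
Proof. by move=> u; apply/asboolP/pcong_refl. Qed.

Lemma pcongb_sym : symmetric pcongb.
Proof. by move=> u v; apply/asboolP/asboolP; apply: pcong_sym. Qed.

Lemma pcongb_trans : transitive pcongb.
Proof.
by move=> v u w /asboolP uv /asboolP vw; apply/asboolP/(pcong_trans uv).
Qed.

Canonical pcong_equiv := EquivRel pcongb pcongb_refl pcongb_sym pcongb_trans.

Definition palg : Type := {eq_quot pcong_equiv}.

HB.instance Definition _ := Choice.on palg.
HB.instance Definition _ := EqQuotient.on palg.

Lemma palgP u v : reflect (\pi_palg u = \pi_palg v) `[< pcong r u v >].
Proof. exact: (@eqquotP _ pcong_equiv palg u v). Qed.

Lemma palgE u v : pcong r u v -> \pi_palg u = \pi_palg v.
Proof. by move=> /asboolP/palgP. Qed.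

Lemma palg_repr u : pcong r (repr (\pi_palg u)) u.
Proof. by apply/asboolP/palgP; rewrite reprK. Qed.

Definition palg_cst (c : R) : palg := \pi_palg (PCst c).
Definition palg_gen (x : X) : palg := \pi_palg (PGen x).
Definition palg_add (x y : palg) : palg := \pi_palg (repr x + repr y)%P.
Definition palg_mul (x y : palg) : palg := \pi_palg (repr x * repr y)%P.
Definition palg_opp (x : palg) : palg := palg_mul (palg_cst (-1)) x.
Definition palg_scale (c : R) (x : palg) : palg := palg_mul (palg_cst c) x.

Lemma palg_addE u v : palg_add (\pi_palg u) (\pi_palg v) = \pi_palg (u + v)%P.
Proof. by apply: palgE; apply: pcong_add; apply: palg_repr. Qed.

Lemma palg_mulE u v : palg_mul (\pi_palg u) (\pi_palg v) = \pi_palg (u * v)%P.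
Proof. by apply: palgE; apply: pcong_mul; apply: palg_repr. Qed.

Lemma palg_addA : associative palg_add.
Proof.
elim/quotW=> u; elim/quotW=> v; elim/quotW=> w.
rewrite (palg_addE v w) (palg_addE u v) !palg_addE.
exact/palgE/pcong_addA.
Qed.

Lemma palg_addC : commutative palg_add.
Proof.
by elim/quotW=> u; elim/quotW=> v; rewrite !palg_addE; apply/palgE/pcong_addC.
Qed.

Lemma palg_add0 : left_id (palg_cst 0) palg_add.
Proof. by elim/quotW=> u; rewrite palg_addE; apply/palgE/pcong_add0. Qed.

Lemma palg_addN : left_inverse (palg_cst 0) palg_opp palg_add.
Proof.
elim/quotW=> u; rewrite /palg_opp palg_mulE palg_addE.
exact/palgE/pcong_addN.
Qed.

HB.instance Definition _ :=
  GRing.isZmodule.Build palg palg_addA palg_addC palg_add0 palg_addN.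

Lemma palg_mulA : associative palg_mul.
Proof.
elim/quotW=> u; elim/quotW=> v; elim/quotW=> w.
rewrite (palg_mulE v w) (palg_mulE u v) !palg_mulE.
exact/palgE/pcong_mulA.
Qed.

Lemma palg_mul1l : left_id (palg_cst 1) palg_mul.
Proof. by elim/quotW=> u; rewrite palg_mulE; apply/palgE/pcong_mul1l. Qed.

Lemma palg_mul1r : right_id (palg_cst 1) palg_mul.
Proof. by elim/quotW=> u; rewrite palg_mulE; apply/palgE/pcong_mul1r. Qed.

Lemma palg_mulDl : left_distributive palg_mul palg_add.
Proof.
elim/quotW=> u; elim/quotW=> v; elim/quotW=> w.
rewrite (palg_addE u v) (palg_mulE u w) (palg_mulE v w) palg_mulE palg_addE.
exact/palgE/pcong_mulDl.
Qed.

Lemma palg_mulDr : right_distributive palg_mul palg_add.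
Proof.
elim/quotW=> u; elim/quotW=> v; elim/quotW=> w.
rewrite (palg_addE v w) (palg_mulE u v) (palg_mulE u w) palg_mulE palg_addE.
exact/palgE/pcong_mulDr.
Qed.

HB.instance Definition _ := GRing.Zmodule_isPzRing.Build palg
  palg_mulA palg_mul1l palg_mul1r palg_mulDl palg_mulDr.

Lemma palg_scaleA c d x : palg_scale c (palg_scale d x) = palg_scale (c * d) x.
Proof.
rewrite /palg_scale palg_mulA; congr palg_mul.
by rewrite palg_mulE; apply/esym/palgE/pcong_cstM.
Qed.

Lemma palg_scale1 : left_id 1 palg_scale.
Proof. exact: palg_mul1l. Qed.

Lemma palg_scaleDr : right_distributive palg_scale +%R.
Proof. by move=> c x y; apply: palg_mulDr. Qed.

Lemma palg_scaleDl x : {morph palg_scale^~ x : c d / c + d}.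
Proof.
move=> c d; rewrite /palg_scale -[RHS]palg_mulDl; congr palg_mul.
by rewrite palg_addE; apply/palgE/pcong_cstD.
Qed.

HB.instance Definition _ := GRing.Zmodule_isLmodule.Build R palg
  palg_scaleA palg_scale1 palg_scaleDr palg_scaleDl.

(* Together with the instances above, these make [palg] an R-algebra; the
   library's [algType R] would moreover require 1 != 0. *)
Lemma palg_scaleAl (c : R) (x y : palg) : c *: (x * y) = c *: x * y.
Proof. exact: palg_mulA. Qed.

Lemma palg_scaleAr (c : R) (x y : palg) : c *: (x * y) = x * (c *: y).
Proof.
rewrite -[LHS]/(palg_mul (palg_cst c) (palg_mul x y)).
rewrite -[RHS]/(palg_mul x (palg_mul (palg_cst c) y)) !palg_mulA.
congr palg_mul; elim/quotW: x => u; rewrite !palg_mulE.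
exact/palgE/pcong_cstC.
Qed.

End PresentedAlgebra.

(* A = Z[a, v] as Z[a][v], and A_v = Z[a, v, v^-1] as the elements p / v^k of
   the fraction field of A.

   Below, [xget x0 P] renders a definite description: for arguments in the group
   W H_b, P has exactly one element (in the case of [Rstar], only its values on
   W H_b are determined), and x0 is a dummy. *)

Definition ringA : idomainType := {poly {poly int}}.
Definition ind_a : ringA := ('X : {poly int})%:P.
Definition ind_v : ringA := 'X.

Definition Av_pred : {pred {fraction ringA}} :=
  fun x => `[< exists (p : ringA) (k : nat), x = tofrac p / tofrac ind_v ^+ k >].

Lemma ind_v_neq0 : tofrac ind_v != 0.
Proof. by rewrite tofrac_eq0 polyX_eq0. Qed.

Lemma Av_subring_closed : subring_closed Av_pred.
Proof.
have nz k : tofrac ind_v ^+ k != 0 by rewrite expf_neq0 ?ind_v_neq0.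
split.
- by apply/asboolP; exists 1, 0; rewrite expr0 divr1 tofrac1.
- move=> x y /asboolP[p [k ->]] /asboolP[q [l ->]]; apply/asboolP.
  exists (p * ind_v ^+ l - q * ind_v ^+ k), (k + l)%N.
  by rewrite -mulNr addf_div // tofracB !tofracM !tofracXn exprD mulNr.
- move=> x y /asboolP[p [k ->]] /asboolP[q [l ->]]; apply/asboolP.
  by exists (p * q), (k + l)%N; rewrite mulf_div exprD tofracM.
Qed.

HB.instance Definition _ :=
  GRing.isSubringClosed.Build {fraction ringA} Av_pred Av_subring_closed.

Record Av := MkAv { Av_val : {fraction ringA}; Av_valP : Av_val \in Av_pred }.

HB.instance Definition _ := [isSub for Av_val].
HB.instance Definition _ := [Choice of Av by <:].
HB.instance Definition _ := [SubChoice_isSubComNzRing of Av by <:].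

Lemma A_in_Av (p : ringA) : tofrac p \in Av_pred.
Proof. by apply/asboolP; exists p, 0; rewrite expr0 divr1. Qed.

Definition A_to_Av (p : ringA) : Av := MkAv (A_in_Av p).

Lemma vinv_in_Av : (tofrac ind_v)^-1 \in Av_pred.
Proof. by apply/asboolP; exists 1, 1; rewrite tofrac1 mul1r. Qed.

Definition Av_vinv : Av := MkAv vinv_in_Av.

Definition is_bar (f : Av -> Av) : Prop :=
  [/\ GRing.zmod_morphism f, GRing.monoid_morphism f,
      f (A_to_Av ind_v) = Av_vinv
    & f (A_to_Av ind_a) = - A_to_Av ind_a * Av_vinv ^+ 2].

Definition bar : Av -> Av := @xget (Av -> Av : choiceType) id [set f | is_bar f].

Section Group.
Variables (F : finFieldType) (m : nat).

Definition unitN1 : {unit F} := FinRing.unit F (@unitrN1 F).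

Lemma perm_mx_is_unit (s : 'S_m.+1) :
  (perm_mx s : 'M[F]_m.+1) \is a GRing.unit.
Proof. exact: unitmx_perm. Qed.

(* [i : 'I_m] stands for the index i+1 in {1, ..., n-1}, where n = m+1. *)
Definition refl (i : 'I_m) : {'GL_m.+1[F]} :=
  FinRing.unit _ (perm_mx_is_unit (tperm (widen_ord (leqnSn m) i) (lift ord0 i))).

Definition hdiag_mx (i : 'I_m.+1) (c : {unit F}) : 'M[F]_m.+1 :=
  diag_mx (\row_j if j == i then val c else 1).

Lemma hdiag_mx_is_unit i c : hdiag_mx i c \is a GRing.unit.
Proof.
rewrite [_ \is a _]unitmxE det_diag unitr_prod // => j _.
by rewrite mxE; case: ifP => _; rewrite ?unitr1 ?(valP c).
Qed.

Definition hdiag (i : 'I_m.+1) (c : {unit F}) : {'GL_m.+1[F]} :=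
  FinRing.unit _ (hdiag_mx_is_unit i c).

Definition Wperm : {set {'GL_m.+1[F]}} := [set g | is_perm_mx (GLval g)].

Definition wprod (s : seq 'I_m) : {'GL_m.+1[F]} := (\prod_(i <- s) refl i)%g.

Definition lenW (w : {'GL_m.+1[F]}) : nat :=
  xget 0 [set p | (exists2 s, wprod s = w & size s = p) /\
                  (forall s, wprod s = w -> (p <= size s)%N)].

Variable Fb : {group {unit F}}.

(* Here b = #|Fb|. *)
Definition hdiag2 (i j : 'I_m.+1) (c : {unit F}) : {'GL_m.+1[F]} :=
  (hdiag i c * hdiag j (unitN1 ^+ (#|Fb|).-1 * c^-1))%g.

Definition Xs (i : 'I_m) : {set {'GL_m.+1[F]}} :=
  [set hdiag2 (widen_ord (leqnSn m) i) (lift ord0 i) c | c in Fb].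

Definition Hb : {set {'GL_m.+1[F]}} :=
  [set g | is_diag_mx (GLval g) &
     [forall i, exists c in Fb, GLval g i i == val c]].

Definition WHb : {set {'GL_m.+1[F]}} := (Wperm * Hb)%g.

Definition hb := {d : {'GL_m.+1[F]} | d \in Hb}.

(* The factor w of x = w d, with w in Wperm and d in Hb. *)
Definition wpart (x : {'GL_m.+1[F]}) : {'GL_m.+1[F]} :=
  odflt 1%g [pick w in Wperm | (w^-1 * x)%g \in Hb].

Definition ell (x : {'GL_m.+1[F]}) : nat := lenW (wpart x).

Definition reduced (s : seq 'I_m) : Prop := ell (wprod s) = size s.

Inductive gen := Gs of 'I_m | Gd of hb.

Local Notation "''t_s' i" := (PGen (Gs i)) (at level 8, i at level 2).
Local Notation "''t_d' d" := (PGen (Gd d)) (at level 8, d at level 2).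

Inductive hecke_rel : pterm ringA gen -> pterm ringA gen -> Prop :=
| hecke_one d : val d = 1%g -> hecke_rel ('t_d d) (PCst 1)
| hecke_dd d d' e : val e = (val d * val d')%g ->
    hecke_rel ('t_d d * 't_d d') ('t_d e)
| hecke_ds d e i : val e = (refl i * val d * refl i)%g ->
    hecke_rel ('t_d d * 't_s i) ('t_s i * 't_d e)
| hecke_comm (i j : 'I_m) : (i.+1 < j)%N || (j.+1 < i)%N ->
    hecke_rel ('t_s i * 't_s j) ('t_s j * 't_s i)
| hecke_braid (i j : 'I_m) : j = i.+1 :> nat ->
    hecke_rel ('t_s i * 't_s j * 't_s i) ('t_s j * 't_s i * 't_s j)
| hecke_quad i :
    hecke_rel ('t_s i * 't_s i)
      (PCst (ind_v ^+ 2)%R +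
       PCst ind_a *
         \big[@PAdd _ _/PCst 0]_(d : hb | val d \in Xs i)
           ('t_d d * 't_s i)%P).

Definition hecke := palg hecke_rel.

Definition t_basis (x : {'GL_m.+1[F]}) : hecke :=
  xget 0 [set y | exists (s : seq 'I_m) (d : hb),
    [/\ reduced s, x = (wprod s * val d)%g
      & y = (\prod_(i <- s) palg_gen hecke_rel (Gs i)) *
            palg_gen hecke_rel (Gd d)]].

(* The A_v-algebra obtained from [hecke] by extension of scalars along
   A -> A_v: generated by symbols 1 (x) y for y in [hecke], the map
   y |-> 1 (x) y being a homomorphism of A-algebras. *)
Inductive tens_rel : pterm Av hecke -> pterm Av hecke -> Prop :=
| tens_one : tens_rel (PGen 1) (PCst 1)
| tens_add y z : tens_rel (PGen (y + z)%R) (PGen y + PGen z)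
| tens_mul y z : tens_rel (PGen (y * z)%R) (PGen y * PGen z)
| tens_scale (c : ringA) y :
    tens_rel (PGen (c *: y)) (PCst (A_to_Av c) * PGen y).

Definition hecke_v := palg tens_rel.

Definition T_basis (x : {'GL_m.+1[F]}) : hecke_v :=
  Av_vinv ^+ ell x *: palg_gen tens_rel (t_basis x).

Definition barT (x : {'GL_m.+1[F]}) : hecke_v :=
  xget 0 [set y | y * T_basis x^-1%g = 1 /\ T_basis x^-1%g * y = 1].

Definition Rstar : {'GL_m.+1[F]} -> {'GL_m.+1[F]} -> Av :=
  @xget ({'GL_m.+1[F]} -> {'GL_m.+1[F]} -> Av : choiceType) (fun _ _ => 0)
    [set R | forall y, y \in WHb ->
      barT y = \sum_(x in WHb) bar (R x y) *: T_basis x].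

(* Only meaningful for x and y in [WHb]. *)
Definition rleq (x y : {'GL_m.+1[F]}) : Prop := Rstar x y <> 0.

Definition distinguished (p : nat) (s : p.-tuple 'I_m)
    (xs : p.+1.-tuple {'GL_m.+1[F]}) : Prop :=
  [/\ forall j, tnth xs j \in WHb,
      tnth xs ord0 = 1%g
    & forall j : 'I_p,
        let x := tnth xs (widen_ord (leqnSn p) j) in
        let x' := tnth xs (lift ord0 j) in
        let sigma := tnth s j in
        (x^-1 * x')%g \in refl sigma |: Xs sigma /\
        rleq x' (x * refl sigma)%g].

Definition pi_s (p : nat) (xs : p.+1.-tuple {'GL_m.+1[F]}) : {'GL_m.+1[F]} :=
  tnth xs ord_max.

End Group.

(* Main.v *)
Require Import Defs.
From HB Require Import structures.
From mathcomp Require Import all_boot all_order all_algebra all_fingroup all_solvable.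
From mathcomp Require Import generic_quotient fraction zify.
From mathcomp Require Import boolp classical_sets.

(** Put [xi = a / v] and [T_s^-1 = T_s - xi * \sum_(d in X_s) T_d]. Then
    [T_x T_s^-1] is [T_(xs)] if [xs] is shorter than [x], and
    [T_(xs) - xi * \sum_(d in X_s) T_(xd)] otherwise, so the coordinates of the
    bar conjugate of [T_w] are polynomials in [- xi] with nonnegative
    coefficients: nothing cancels, and [x <= w] holds exactly when [x] is
    reached from [1] by steps [x -> xs] and, where [xs] is longer than [x],
    [x -> xd]. The same formula gives [xd <= xs] in the latter case, while
    [xd <= xs] is impossible for [xs] shorter than [x] because [<=] is
    compatible with the length; so these steps are the distinguished ones.

    The coordinates are meaningful because the [T_x] are well defined
    (Matsumoto's theorem for the symmetric group) and linearly independent (the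
    presented algebra acts on functions on [W H_b] by the formulas expected of
    left multiplication; the braid relations need only be checked over the
    identity permutation, since these operators commute with those of right
    multiplication). *)

Set Implicit Arguments.
Unset Strict Implicit.
Unset Printing Implicit Defensive.

Import GroupScope Order.TTheory GRing.Theory Num.Theory.

(** * Inversions and reduced words in the symmetric group *)

Section SymmetricGroup.
Variable m : nat.
Implicit Types (i j : 'I_m) (k l : 'I_m.+1) (w : 'S_m.+1) (s u : seq 'I_m).

Definition ileft i : 'I_m.+1 := widen_ord (leqnSn m) i.
Definition iright i : 'I_m.+1 := lift ord0 i.
Definition strans i : 'S_m.+1 := tperm (ileft i) (iright i).

Lemma val_iright i : iright i = i.+1 :> nat. Proof. exact: lift0. Qed.

Lemma ileft_neq_iright i : ileft i != iright i.
Proof. by apply/eqP => /(congr1 val) /=; rewrite /bump /=; lia. Qed.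

(** Turns equalities between products of [strans] into arithmetic in [nat], settled by case splits
    and [lia]. *)
Lemma val_strans i k :
  strans i k = (if k == i :> nat then i.+1 else if k == i.+1 :> nat then i : nat else k)
  :> nat.
Proof.
rewrite /strans; case: tpermP => [->|->|h0 h1].
- by rewrite val_iright /= eqxx.
- by rewrite val_iright eqxx; case: eqP => //=; lia.
have : (k : nat) <> ileft i by move=> /val_inj.
have : (k : nat) <> iright i by move=> /val_inj.
by rewrite val_iright /=; do !case: eqP.
Qed.

Lemma strans_sq i : strans i * strans i = 1.
Proof. exact: tperm2. Qed.

Lemma stransV i : (strans i)^-1 = strans i.
Proof. exact: tpermV. Qed.

Lemma strans_comm i j : (i.+1 < j) || (j.+1 < i) ->
  strans i * strans j = strans j * strans i.
Proof.
move=> h; apply/permP => k; apply/ord_inj; rewrite !permM !val_strans.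
by do !case: eqP => //; lia.
Qed.

Lemma strans_braid i j : j = i.+1 :> nat ->
  strans i * strans j * strans i = strans j * strans i * strans j.
Proof.
move=> h; apply/permP => k; apply/ord_inj; rewrite !permM !val_strans.
by do !case: eqP => //; lia.
Qed.

(* As [(s * t) k = t (s k)] in ['S_n], this says that [i] is a left descent
   of [w]; right descents of [w] are the [i] with [descent i w^-1]. *)
Definition descent i w := w (iright i) < w (ileft i).

Lemma strans_ileft i : strans i (ileft i) = iright i.
Proof. exact: tpermL. Qed.

Lemma strans_iright i : strans i (iright i) = ileft i.
Proof. exact: tpermR. Qed.

Lemma perm_ileft_neq i w : (w (ileft i) : nat) <> w (iright i).
Proof. by move=> /val_inj /perm_inj /eqP; apply/negP/ileft_neq_iright. Qed.

Lemma descent1 i : descent i 1 = false.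
Proof. by rewrite /descent !perm1 val_iright /=; lia. Qed.

Lemma descent_strans i w : descent i (strans i * w) = ~~ descent i w.
Proof.
rewrite /descent !permM strans_ileft strans_iright.
have := @perm_ileft_neq i w; lia.
Qed.

(** [strans j] changes the order of two values only if they are [j] and [j.+1]. If [w] takes these
    values at the two places of [i], then [strans i * w = w * strans j], which is excluded. *)
Lemma descent_mulr i j w : strans i * w != w * strans j ->
  descent i (w * strans j) = descent i w.
Proof.
move=> ne; rewrite /descent !permM !val_strans.
have hne := @perm_ileft_neq i w.
have [[e1 e2]|h1] := pselect (w (ileft i) = j :> nat /\ w (iright i) = j.+1 :> nat);
  last have [[e1 e2]|h2] := pselect (w (ileft i) = j.+1 :> nat /\ w (iright i) = j :> nat).
- case/eqP: ne; apply/permP => k; apply/ord_inj; rewrite !permM val_strans /=.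
  have [->|k0] := eqVneq k (ileft i).
    by rewrite strans_ileft e1 eqxx e2.
  have [->|k1] := eqVneq k (iright i).
    by rewrite strans_iright e2 e1 eqxx; case: eqP; lia.
  rewrite tpermD 1?eq_sym //.
  have : (w k : nat) <> w (ileft i) by move=> /val_inj /perm_inj /eqP; apply/negP.
  have : (w k : nat) <> w (iright i) by move=> /val_inj /perm_inj /eqP; apply/negP.
  by do !case: eqP => //; lia.
- case/eqP: ne; apply/permP => k; apply/ord_inj; rewrite !permM val_strans /=.
  have [->|k0] := eqVneq k (ileft i).
    by rewrite strans_ileft e1 e2 eqxx; case: eqP; lia.
  have [->|k1] := eqVneq k (iright i).
    by rewrite strans_iright e2 e1 eqxx.
  rewrite tpermD 1?eq_sym //.
  have : (w k : nat) <> w (ileft i) by move=> /val_inj /perm_inj /eqP; apply/negP.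
  have : (w k : nat) <> w (iright i) by move=> /val_inj /perm_inj /eqP; apply/negP.
  by do !case: eqP => //; lia.
- by do !case: eqP => //; lia.
Qed.

(** Evaluation at [ileft i] shows that [strans j] sends [w (ileft i)] to [w (iright i)]; these
    differ, so [w (ileft i)] is one of the two points it moves. *)
Lemma strans_conj i j w : strans i * w = w * strans j ->
  (w (ileft i) = ileft j /\ w (iright i) = iright j) \/
  (w (ileft i) = iright j /\ w (iright i) = ileft j).
Proof.
move=> e; have := congr1 (fun t : 'S_m.+1 => t (ileft i)) e.
rewrite !permM strans_ileft => e1.
have ne := @perm_ileft_neq i w.
have := congr1 val e1; rewrite /= val_strans.
case: eqP => h1 h2.
  by left; split; apply/ord_inj; rewrite ?val_iright.
by case: eqP h2 => h2 h3; [right; split; apply/ord_inj; rewrite ?val_iright | lia].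
Qed.

Lemma descent_conj i j w : strans i * w = w * strans j ->
  descent i w = descent j w^-1.
Proof.
have wV k l : w k = l -> w^-1 l = k by move=> <-; rewrite permK.
by move=> /strans_conj[] [e0 e1]; rewrite /descent e0 e1 (wV _ _ e0) (wV _ _ e1)
  !val_iright /=; apply/idP/idP; lia.
Qed.

Definition inversions w := [set p : 'I_m.+1 * 'I_m.+1 | (p.1 < p.2) && (w p.2 < w p.1)].
Definition inv_number w := #|inversions w|.

(** Moving both members of a pair by [strans i] keeps their order unless they are the two swapped
    places. So the inversions of the product are those of [w], transported, and one new pair. *)
Lemma inv_number_up i w : ~~ descent i w ->
  inv_number (strans i * w) = (inv_number w).+1.
Proof.
move=> up; rewrite /inv_number.
pose f (p : 'I_m.+1 * 'I_m.+1) := (strans i p.1, strans i p.2).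
have finj : injective f by move=> [k l] [k' l'] [/perm_inj -> /perm_inj ->].
have -> : inversions (strans i * w) =
          (ileft i, iright i) |: (f @^-1: inversions w).
  apply/setP => -[k l]; rewrite !inE /= !permM.
  have lt_w : w (ileft i) < w (iright i).
    by move: up; rewrite /descent; have := @perm_ileft_neq i w; lia.
  have [[-> ->]|ne] := eqVneq (k, l) (ileft i, iright i).
    by rewrite strans_ileft strans_iright lt_w val_iright /= ltnS leqnn.
  have [[-> ->]|ne'] := eqVneq (k, l) (iright i, ileft i).
    rewrite !strans_ileft !strans_iright (ltnNge (w (iright i))) (ltnW lt_w).
    by rewrite !andbF.
  rewrite orFb; congr andb; rewrite !val_strans.
  have : ~ (k = i :> nat /\ l = i.+1 :> nat).
    move=> [e1 e2]; case/eqP: ne; congr pair; exact/ord_inj.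
  have : ~ (k = i.+1 :> nat /\ l = i :> nat).
    move=> [e1 e2]; case/eqP: ne'; congr pair; exact/ord_inj.
  by do !case: eqP => //; lia.
rewrite cardsU1 card_preimset // !inE /= strans_ileft strans_iright val_iright /=.
by rewrite ltnNge leqnSn.
Qed.

Lemma inv_number_down i w : descent i w ->
  (inv_number (strans i * w)).+1 = inv_number w.
Proof.
move=> dn; rewrite -(@inv_number_up i) ?descent_strans ?dn //.
by rewrite mulgA strans_sq mul1g.
Qed.

Lemma inv_number1 : inv_number 1 = 0%N.
Proof.
apply/eqP; rewrite cards_eq0; apply/eqP/setP => -[k l].
by rewrite !inE !perm1 /=; apply/negP; lia.
Qed.

(** Without descents [w] is increasing, so [k <= w k] for all [k]; both sides have the same sum over
    [k], which forces equality everywhere. *)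
Lemma exists_descent w : w != 1 -> exists i, descent i w.
Proof.
apply: contraNP => nd.
have le k : k <= w k.
  case: k => k; elim: k => [//|k IH] hk.
  have hk' : k < m by [].
  have := IH (ltnW hk); rewrite /=; set kk := Ordinal _ => h.
  have e0 : kk = ileft (Ordinal hk') by apply/ord_inj.
  have e1 : Ordinal hk = iright (Ordinal hk') by apply/ord_inj; rewrite val_iright.
  have := @perm_ileft_neq (Ordinal hk') w.
  have : ~ descent (Ordinal hk') w by move=> d; apply: nd; exists (Ordinal hk').
  by rewrite /descent e1 -e0; lia.
apply/eqP/permP => k; apply/ord_inj; rewrite perm1 /=.
have [_] := leqif_sum (fun k (_ : true) => leqif_eq (le k)).
have -> : (\sum_(k < m.+1) w k = \sum_(k < m.+1) k)%N.
  exact/esym/(reindex_perm w).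
rewrite eqxx.
by move=> /esym /forallP /(_ k) /= /eqP.
Qed.

Definition pword s : 'S_m.+1 := \prod_(i <- s) strans i.

Lemma pword_cons i s : pword (i :: s) = strans i * pword s.
Proof. exact: big_cons. Qed.

Lemma pword_rcons i s : pword (rcons s i) = pword s * strans i.
Proof. by rewrite /pword -cats1 big_cat big_seq1. Qed.

Lemma pword_rev s : pword (rev s) = (pword s)^-1.
Proof.
elim: s => [|i s IH]; first by rewrite /pword big_nil invg1.
by rewrite rev_cons pword_rcons IH pword_cons invMg stransV.
Qed.

Lemma inv_number_word s : inv_number (pword s) <= size s.
Proof.
elim: s => [|i s IH]; first by rewrite /pword big_nil inv_number1.
rewrite pword_cons /=; case: (boolP (descent i (pword s))) => [/inv_number_down|/inv_number_up];
by lia.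
Qed.

(** The number of inversions stands for the length; [reducedE] relates this to [reduced]. *)
Definition rword s := inv_number (pword s) == size s.

Lemma exists_rword w : exists2 s, rword s & pword s = w.
Proof.
have [n] := ubnP (inv_number w); elim: n w => // n IH w lt_w.
have [->|/exists_descent[i di]] := eqVneq w 1.
  by exists [::]; rewrite /rword /pword ?big_nil ?inv_number1.
have d := inv_number_down di.
have [|s rs es] := IH (strans i * w); first by move: lt_w; rewrite -d; lia.
exists (i :: s); last by rewrite pword_cons es mulgA strans_sq mul1g.
by move: rs; rewrite /rword pword_cons es mulgA strans_sq mul1g -d.
Qed.

(** The reverse of a reduced word is a word of the inverse, of the same size; this is applied to [w]
    and to [w^-1]. *)
Lemma inv_numberV w : inv_number w^-1 = inv_number w.
Proof.
have le w' : inv_number w'^-1 <= inv_number w'.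
  have [s /eqP rs <-] := exists_rword w'.
  by rewrite rs -pword_rev -size_rev inv_number_word.
by apply/eqP; rewrite eqn_leq le -{1}(invgK w) le.
Qed.

Lemma rword_cons i s : rword (i :: s) = rword s && ~~ descent i (pword s).
Proof.
rewrite /rword pword_cons /=; have := inv_number_word s.
case: (boolP (descent i (pword s))) => [/inv_number_down|/inv_number_up].
  by rewrite andbF => e h; apply/eqP; lia.
by rewrite andbT => -> _; rewrite eqSS.
Qed.

Lemma rword_rev s : rword (rev s) = rword s.
Proof. by rewrite /rword pword_rev inv_numberV size_rev. Qed.

Lemma rword_rcons i s : rword (rcons s i) = rword s && ~~ descent i (pword s)^-1.
Proof. by rewrite -rword_rev rev_rcons rword_cons rword_rev pword_rev. Qed.

Lemma inv_number_mulr i w :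
  inv_number (w * strans i) =
  if descent i w^-1 then (inv_number w).-1 else (inv_number w).+1.
Proof.
rewrite -inv_numberV invMg stransV -(inv_numberV w).
by case: ifP => [/inv_number_down <-|/negbT/inv_number_up].
Qed.

Lemma descent_far i j w : (i.+1 < j) || (j.+1 < i) ->
  descent j (strans i * w) = descent j w.
Proof.
move=> h; rewrite /descent !permM !tpermD //; apply/eqP => /(congr1 val);
by rewrite /= /bump /=; lia.
Qed.

Lemma iright_ileft i j : j = i.+1 :> nat -> iright i = ileft j.
Proof. by move=> e; apply/ord_inj; rewrite val_iright -e. Qed.

(** The values of [w] at the three consecutive places decrease, so a reduced word of [w] can start
    with [i j i] as well as with [j i j]. *)
Lemma descent_braid i j w : j = i.+1 :> nat -> descent i w -> descent j w ->
  [/\ descent j (strans i * w), descent i (strans j * (strans i * w)),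
      descent i (strans j * w) & descent j (strans i * (strans j * w))].
Proof.
move=> e; have eij := iright_ileft e.
have si : strans i (iright j) = iright j.
  by apply: tpermD; apply/eqP => /(congr1 val); rewrite /= /bump /=; lia.
have sj : strans j (ileft i) = ileft i.
  by apply: tpermD; apply/eqP => /(congr1 val); rewrite /= /bump /=; lia.
rewrite /descent !permM -?eij ?si ?sj strans_ileft strans_iright eij.
rewrite strans_ileft ?strans_iright -?eij ?sj ?si ?strans_ileft ?strans_iright.
rewrite ?eij ?strans_ileft ?strans_iright -?eij ?strans_ileft ?strans_iright ?si.
by move=> h1 h2; split => //; apply: ltn_trans h1.
Qed.

(** * Independence of the choice of a reduced word *)

Section Matsumoto.
Variables (A : pzRingType) (t : 'I_m -> A).
Hypothesis t_comm : forall i j, (i.+1 < j) || (j.+1 < i) -> (t i * t j = t j * t i)%R.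
Hypothesis t_braid : forall i j, j = i.+1 :> nat ->
  (t i * t j * t i = t j * t i * t j)%R.

(** Induction on the size. If the first letters differ, both are left descents, so there are reduced
    words of the same permutation that start with the two sides of their commutation or braid
    relation and share the rest. The tails of [s] and [u] are compared with these by induction. *)
Lemma matsumoto s u : rword s -> rword u -> pword s = pword u ->
  (\prod_(i <- s) t i = \prod_(i <- u) t i)%R.
Proof.
have [n] := ubnP (size s); elim: n s u => // n IH s u lt_s rs ru e.
have es : size s = size u by rewrite -(eqP rs) -(eqP ru) e.
case: s u lt_s rs ru e es => [|i s] [|j u] //= /ltnSE lt_s rs ru e [es].
have IHw s' u' : rword s' -> rword u' -> pword s' = pword u' -> size s' < n ->
  (\prod_(i <- s') t i = \prod_(i <- u') t i)%R by move=> *; exact: IH.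
have hs : pword s = strans i * pword (i :: s).
  by rewrite pword_cons mulgA strans_sq mul1g.
have hu : pword u = strans j * pword (i :: s).
  by rewrite e pword_cons mulgA strans_sq mul1g.
have di : descent i (pword (i :: s)).
  by move: rs; rewrite rword_cons pword_cons descent_strans => /andP[].
have dj : descent j (pword (i :: s)).
  by move: ru; rewrite e rword_cons pword_cons descent_strans => /andP[].
have rs' : rword s by move: rs; rewrite rword_cons => /andP[].
have ru' : rword u by move: ru; rewrite rword_cons => /andP[].
rewrite !big_cons.
have [eij|neij] := eqVneq i j.
  by rewrite eij (IHw s u) // hs hu eij.
have braid (a b : 'I_m) s1 u1 : b = a.+1 :> nat -> rword s1 -> rword u1 ->
    pword s1 = strans a * pword (i :: s) -> pword u1 = strans b * pword (i :: s) ->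
    size s1 < n -> size u1 < n ->
    descent a (pword (i :: s)) -> descent b (pword (i :: s)) ->
  (t a * \prod_(i <- s1) t i = t b * \prod_(i <- u1) t i)%R.
  move=> eb r1 r2 e1 e2 l1 l2 da db.
  have [d1 d2 d3 d4] := descent_braid eb da db.
  (* [z] is what remains of [pword (i :: s)] when [a b a], or equally [b a b], is removed from the
     front. *)
  have [z rz ez] := exists_rword (strans a * (strans b * (strans a * pword (i :: s)))).
  have ez' : pword z = strans b * (strans a * (strans b * pword (i :: s))).
    by rewrite ez !mulgA strans_braid.
  have rz1 : rword (a :: z) by rewrite rword_cons rz ez descent_strans d2.
  have ez1 : pword (a :: z) = strans b * (strans a * pword (i :: s)).
    by rewrite pword_cons ez mulgA strans_sq mul1g.
  have rz2 : rword (b :: z) by rewrite rword_cons rz ez' descent_strans d4.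
  have ez2 : pword (b :: z) = strans a * (strans b * pword (i :: s)).
    by rewrite pword_cons ez' mulgA strans_sq mul1g.
  rewrite (IHw s1 [:: b, a & z]) //; first last.
  - by rewrite pword_cons ez1 e1 !mulgA strans_sq mul1g.
  - by rewrite rword_cons rz1 ez1 descent_strans d1.
  rewrite (IHw u1 [:: a, b & z]) //; first last.
  - by rewrite pword_cons ez2 e2 !mulgA strans_sq mul1g.
  - by rewrite rword_cons rz2 ez2 descent_strans d3.
  by rewrite !big_cons !mulrA t_braid.
have [far|] := boolP ((i.+1 < j) || (j.+1 < i)).
  have [z rz ez] := exists_rword (strans j * (strans i * pword (i :: s))).
  have ez' : pword z = strans i * (strans j * pword (i :: s)).
    by rewrite ez !mulgA strans_comm // orbC.
  have rz1 : rword (j :: z).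
    by rewrite rword_cons rz ez descent_strans descent_far // dj.
  have rz2 : rword (i :: z).
    by rewrite rword_cons rz ez' descent_strans descent_far 1?orbC // di.
  rewrite (IHw s (j :: z)) //; last by rewrite pword_cons ez mulgA strans_sq mul1g.
  rewrite (IHw u (i :: z)) -?es //; last by rewrite pword_cons ez' mulgA strans_sq mul1g.
  by rewrite !big_cons !mulrA t_comm.
move=> near; have [eji|eij] : j = i.+1 :> nat \/ i = j.+1 :> nat.
  have : (i : nat) <> j by move=> /val_inj /eqP; apply/negP.
  by lia.
  by apply: (braid i j) => //; rewrite -es.
by apply/esym/(braid j i) => //; rewrite -es.
Qed.

End Matsumoto.
End SymmetricGroup.

(** * Modules over presented algebras *)

Section PalgTheory.
Local Open Scope ring_scope.
Local Open Scope quotient_scope.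
Variables (R : comNzRingType) (X : Type) (r : pterm R X -> pterm R X -> Prop).

Lemma pi_palgD (u v : pterm R X) : \pi_(palg r) (u + v)%P =
  (\pi_(palg r) u + \pi_(palg r) v : palg r).
Proof. exact/esym/palg_addE. Qed.

Lemma pi_palgM (u v : pterm R X) : \pi_(palg r) (u * v)%P =
  (\pi_(palg r) u * \pi_(palg r) v : palg r).
Proof. exact/esym/palg_mulE. Qed.

Lemma pi_palg_cst (c : R) : \pi_(palg r) (PCst c) = c *: (1 : palg r).
Proof. by rewrite -[LHS](@mulr1 (palg r)). Qed.

Lemma pi_palg_sum (I : finType) (P : pred I) (f : I -> pterm R X) :
  \pi_(palg r) (\big[@PAdd _ _/PCst 0]_(i | P i) f i) =
  (\sum_(i | P i) \pi_(palg r) (f i) : palg r).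
Proof.
apply: (big_morph (fun u => \pi_(palg r) u)) => [u v|]; first exact: pi_palgD.
by rewrite pi_palg_cst scale0r.
Qed.

Lemma palg_scaleM (c d : R) (x y : palg r) : (c *: x) * (d *: y) = (c * d) *: (x * y).
Proof. by rewrite -palg_scaleAl -palg_scaleAr scalerA. Qed.

End PalgTheory.

Section PalgAction.
Local Open Scope ring_scope.
Local Open Scope quotient_scope.
Variables (R S : comNzRingType) (phi : {rmorphism R -> S}) (V : lmodType S).
Variables (X : Type) (r : pterm R X -> pterm R X -> Prop) (act : X -> V -> V).

(** Scalars pass through [phi] so that an algebra over [ringA] can act on functions with values in
    [Av]. *)
Fixpoint peval (u : pterm R X) : V -> V :=
  match u with
  | PGen x => act x
  | PCst c => fun f => phi c *: f
  | PAdd u v => fun f => peval u f + peval v f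
  | PMul u v => fun f => peval u (peval v f)
  end.

Hypothesis act_linear : forall x, linear (act x).
Hypothesis act_rel : forall u v, r u v -> peval u =1 peval v.

Lemma peval_linear u : linear (peval u).
Proof.
elim: u => [x|c|u IHu v IHv|u IHu v IHv] //= a f g.
- by rewrite scalerDr !scalerA mulrC.
- by rewrite IHu IHv scalerDr addrACA.
- by rewrite IHv IHu.
Qed.

Lemma pevalD u f g : peval u (f + g) = peval u f + peval u g.
Proof. by have := peval_linear u 1 f g; rewrite !scale1r. Qed.

Lemma pevalZ u c f : peval u (c *: f) = c *: peval u f.
Proof.
have e0 : peval u 0 = 0 by have := peval_linear u (-1) 0 0; rewrite scaler0 addr0 scaleN1r addNr.
by have := peval_linear u c f 0; rewrite !addr0 e0 addr0.
Qed.

(** Linearity of the operators is what right distributivity and the centrality of constants ask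
    for. *)
Lemma peval_cong u v : pcong r u v -> peval u =1 peval v.
Proof.
elim=> {u v} //=.
- by move=> u v _ IH f.
- by move=> u v w _ IH1 _ IH2 f; rewrite IH1.
- by move=> u u' v v' _ IH1 _ IH2 f; rewrite IH1 IH2.
- by move=> u u' v v' _ IH1 _ IH2 f; rewrite IH2 IH1.
- by move=> u v w f; rewrite addrA.
- by move=> u v f; rewrite addrC.
- by move=> u f; rewrite rmorph0 scale0r add0r.
- by move=> u f; rewrite rmorphN rmorph1 rmorph0 scaleN1r scale0r addNr.
- by move=> u f; rewrite rmorph1 scale1r.
- by move=> u f; rewrite rmorph1 scale1r.
- by move=> u v w f; rewrite pevalD.
- by move=> c d f; rewrite rmorphD scalerDl.
- by move=> c d f; rewrite rmorphM scalerA.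
- by move=> c u f; rewrite pevalZ.
Qed.

Definition palg_act (x : palg r) : V -> V := peval (repr x).

Lemma palg_act_pi u : palg_act (\pi_(palg r) u) =1 peval u.
Proof. exact/peval_cong/palg_repr. Qed.

Lemma palg_act_gen x : palg_act (palg_gen r x) =1 act x.
Proof. exact: palg_act_pi. Qed.

Lemma palg_act_linear x : linear (palg_act x).
Proof. exact: peval_linear. Qed.

Lemma palg_act1 f : palg_act 1 f = f.
Proof. by rewrite palg_act_pi /= rmorph1 scale1r. Qed.

Lemma palg_act0 f : palg_act 0 f = 0.
Proof. by rewrite palg_act_pi /= rmorph0 scale0r. Qed.

Lemma palg_actD x y f : palg_act (x + y) f = palg_act x f + palg_act y f.
Proof. by rewrite palg_act_pi. Qed.

Lemma palg_actM x y f : palg_act (x * y) f = palg_act x (palg_act y f).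
Proof. by rewrite palg_act_pi. Qed.

Lemma palg_actZ c x f : palg_act (c *: x) f = phi c *: palg_act x f.
Proof. by rewrite [LHS]palg_act_pi /= [peval (repr (palg_cst r c)) _]palg_act_pi. Qed.

Lemma palg_act_sum (I : finType) (P : pred I) (x : I -> palg r) f :
  palg_act (\sum_(i | P i) x i) f = \sum_(i | P i) palg_act (x i) f.
Proof.
apply: (big_morph (palg_act^~ f)) => [u v|]; [exact: palg_actD | exact: palg_act0].
Qed.

End PalgAction.

(** * Left and right multiplication operators on functions on a group over the symmetric group *)

Section RegularRepresentation.
Variables (m : nat) (gT : finGroupType) (sg : gT -> 'S_m.+1).
Variables (s : 'I_m -> gT) (X : 'I_m -> {set gT}).
Hypothesis sgM : {morph sg : x y / x * y}.
Hypothesis sg_s : forall i, sg (s i) = strans i.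
Hypothesis s_sq : forall i, s i * s i = 1.
Hypothesis s_comm : forall i j : 'I_m, (i.+1 < j) || (j.+1 < i) -> s i * s j = s j * s i.
Hypothesis s_braid : forall i j : 'I_m, j = i.+1 :> nat ->
  s i * s j * s i = s j * s i * s j.
Hypothesis sg_X : forall i e, e \in X i -> sg e = 1.
Hypothesis X_inv : forall i e, (e^-1 \in X i) = (e \in X i).
Hypothesis X_conj : forall i j y e, sg (s i * y) = sg (y * s j) ->
  (s i * y * e * s j * y^-1 \in X i) = (e \in X j).

Variables (K : comNzRingType) (xi : K).
Local Notation V := {ffun gT -> K^o}.
Implicit Types (f : V) (y z d : gT) (i j : 'I_m).

Let sg1 : sg 1 = 1.
Proof. by apply: (mulgI (sg 1)); rewrite -sgM !mulg1. Qed.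

Let sgV y : sg y^-1 = (sg y)^-1.
Proof. by apply: (mulgI (sg y)); rewrite -sgM !mulgV sg1. Qed.

Local Notation dl i y := (descent i (sg y)).
Local Notation dr i y := (descent i (sg y)^-1).

(* Functions on the group stand for linear combinations of its elements, so
   these are the operators of left and right multiplication by [T_i] and of left
   multiplication by [T_d], written on coordinates. *)
Definition opL i f : V :=
  [ffun y => (f (s i * y)%g + (dl i y)%:R * xi * \sum_(d in X i) f (d * y)%g)%R].
Definition opR i f : V :=
  [ffun y => (f (y * s i)%g + (dr i y)%:R * xi * \sum_(d in X i) f (y * d)%g)%R].
Definition opD d f : V := [ffun y => f (d^-1 * y)].

Lemma opL_linear i : linear (opL i).
Proof.
move=> c f g; apply/ffunP => y; rewrite !ffunE.
have -> : (\sum_(d in X i) (c *: f + g)%R (d * y)%g =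
    c * \sum_(d in X i) f (d * y)%g + \sum_(d in X i) g (d * y)%g)%R.
  by rewrite mulr_sumr -big_split; apply: eq_bigr => d _; rewrite !ffunE.
rewrite /GRing.scale /= !mulrDr addrACA; congr (_ + (_ + _))%R.
by rewrite mulrCA.
Qed.

Lemma opD_linear d : linear (opD d).
Proof. by move=> c f g; apply/ffunP => y; rewrite !ffunE. Qed.

Let sg_Xl i e y : e \in X i -> sg (e * y) = sg y.
Proof. by move=> /sg_X h; rewrite sgM h mul1g. Qed.

Let sg_Xr i e y : e \in X i -> sg (y * e) = sg y.
Proof. by move=> /sg_X h; rewrite sgM h mulg1. Qed.

(** The substitution [d = s i * y * e * s j * y^-1] matches the arguments, and [X_conj] matches the
    index sets. *)
Let sum_conj i j y f : sg (s i * y) = sg (y * s j) ->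
  (\sum_(e in X j) f (s i * y * e)%g = \sum_(d in X i) f (d * y * s j)%g)%R.
Proof.
move=> h; rewrite [RHS](reindex (fun e => s i * y * e * s j * y^-1)) /=; last first.
  exists (fun d => (s i * y)^-1 * d * y * s j) => e _; rewrite invMg !mulgA.
    by rewrite !mulgKV mulVg mul1g -mulgA s_sq mulg1.
  by rewrite !mulgK mulgV mul1g -(mulgA (e * y)) s_sq mulg1 mulgK.
apply: eq_big => [e|e _]; first by rewrite X_conj.
by rewrite mulgKV -[_ * s j * s j]mulgA s_sq mulg1.
Qed.

(** Expanded at [y], both sides contain the same double sum. If [s i * y] and [y * s j] lie over
    different permutations, neither multiplication affects the descents on the other side and the
    single sums agree one by one. Otherwise the single sums are all equal by [sum_conj], and the
    descent flags give them the same total coefficient. *)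
Lemma opLR_comm i j f : opL i (opR j f) = opR j (opL i f).
Proof.
apply/ffunP => y; rewrite !ffunE.
have -> : (\sum_(d in X i) opR j f (d * y)%g = \sum_(d in X i) f (d * y * s j)%g +
   (dr j y)%:R * xi * \sum_(d in X i) \sum_(e in X j) f (d * y * e)%g)%R.
  rewrite mulr_sumr -big_split /=; apply: eq_bigr => d dX.
  by rewrite ffunE (sg_Xl _ dX).
have -> : (\sum_(e in X j) opL i f (y * e)%g = \sum_(e in X j) f (s i * y * e)%g +
   (dl i y)%:R * xi * \sum_(d in X i) \sum_(e in X j) f (d * y * e)%g)%R.
  rewrite exchange_big mulr_sumr -big_split /=; apply: eq_bigr => e eX.
  rewrite ffunE (sg_Xr _ eX) mulgA; congr (_ + _ * _)%R.
  by apply: eq_bigr => d _; rewrite mulgA.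
rewrite !mulrDr [(_ * (_ * _ * _))%R]mulrCA !mulgA.
under [X in _ = (_ + _ * X + _)%R]eq_bigr do rewrite mulgA.
have [e|ne] := eqVneq (sg (s i * y)) (sg (y * s j)).
  rewrite (sum_conj _ e); rewrite !sgM !sg_s in e.
  rewrite !sgM !sg_s e invMg stransV descent_strans -(descent_conj e) -e.
  by rewrite descent_strans.
rewrite !sgM !sg_s in ne; rewrite !sgM !sg_s (descent_mulr ne) invMg stransV.
rewrite descent_mulr 1?addrACA //.
apply: contra ne => /eqP ne.
apply/eqP/invg_inj; rewrite !invMg !stransV ne //.
Qed.

(** At an ascent [opR j] is a plain translation, so [T f] at [y * s j] is [T (opR j f)] at [y].
    Agreement at [y] is therefore required for all functions at once. *)
Lemma opR_transport (T T' : V -> V) (j : 'I_m) y :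
  (forall f, T (opR j f) = opR j (T f)) -> (forall f, T' (opR j f) = opR j (T' f)) ->
  dr j y = false -> (forall f, T f y = T' f y) -> forall f, T f (y * s j) = T' f (y * s j).
Proof.
move=> hT hT' h hy f.
have opRy g : opR j g y = g (y * s j) by rewrite ffunE h mul0r mul0r addr0.
by rewrite -(opRy (T f)) -(opRy (T' f)) -hT -hT' hy.
Qed.

(* An operator that commutes with right multiplications is determined by its
   values at the elements over the identity permutation. *)
Lemma opR_ext (T T' : V -> V) :
  (forall j f, T (opR j f) = opR j (T f)) -> (forall j f, T' (opR j f) = opR j (T' f)) ->
  (forall y, sg y = 1 -> forall f, T f y = T' f y) -> T =1 T'.
Proof.
move=> hT hT' h1 f; apply/ffunP => y; move: f.
have [n] := ubnP (inv_number (sg y)^-1); elim: n y => // n IH y lt_y.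
have [e|ne] := eqVneq (sg y) 1; first exact: h1.
have [|j dj] := @exists_descent _ (sg y)^-1; first by rewrite invg_eq1.
have lt' : inv_number (sg (y * s j))^-1 < n.
  by move: lt_y; rewrite -(inv_number_down dj) sgM sg_s invMg stransV ltnS.
have -> : y = (y * s j) * s j by rewrite -mulgA s_sq mulg1.
apply: opR_transport => //; last exact: IH.
by rewrite sgM sg_s invMg stransV descent_strans dj.
Qed.

Let opL_one i y f : dl i y = false -> opL i f y = f (s i * y).
Proof. by move=> h; rewrite ffunE h mul0r mul0r addr0. Qed.

(** Over the identity permutation no operator meets a descent, so only the relation in the group is
    left. *)
Lemma opL_far i j f : (i.+1 < j) || (j.+1 < i) -> opL i (opL j f) = opL j (opL i f).
Proof.
move=> ij; apply: (opR_ext (T := opL i \o opL j) (T' := opL j \o opL i)) => [k g|k g|y y1 g] /=.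
- by rewrite !opLR_comm.
- by rewrite !opLR_comm.
have ji : (j.+1 < i) || (i.+1 < j) by rewrite orbC.
by rewrite !opL_one ?sgM ?sg_s ?descent_far ?y1 ?descent1 // !mulgA s_comm.
Qed.

Lemma opL_braid i j f : j = i.+1 :> nat ->
  opL i (opL j (opL i f)) = opL j (opL i (opL j f)).
Proof.
move=> ij; apply: (opR_ext (T := opL i \o (opL j \o opL i))
  (T' := opL j \o (opL i \o opL j))) => [k g|k g|y y1 g] /=.
- by rewrite !opLR_comm.
- by rewrite !opLR_comm.
(* Both sides of the braid relation are reduced words, so each operator acts at an ascent. *)
have up (a b : 'I_m) : a = b.+1 :> nat \/ b = a.+1 :> nat ->
  descent a (strans b) = false /\ descent a (strans b * strans a) = false.
  move=> ab; rewrite /descent !permM !val_strans !val_iright /=.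
  by do !case: eqP; rewrite ?eqxx //=; do ?case: eqP => //; lia.
have [u1 u2] := up i j (or_intror ij); have [u3 u4] := up j i (or_introl ij).
by rewrite !opL_one ?sgM ?sg_s ?y1 ?mulg1 ?descent1 ?u1 ?u2 ?u3 ?u4 // !mulgA s_braid.
Qed.

Let X_conj_s i e : (s i * e * s i \in X i) = (e \in X i).
Proof. by rewrite -[RHS](@X_conj i i 1) ?invg1 ?mulg1 ?mul1g. Qed.

Let sX i f y : (\sum_(d in X i) f (d * (s i * y))%g = \sum_(d in X i) f (s i * (d * y))%g)%R.
Proof.
rewrite (reindex_inj (_ : injective (fun d => s i * d * s i))) /=; last first.
  by move=> d e /mulIg/mulgI.
apply: eq_big => [d|d _]; first exact: X_conj_s.
by rewrite !mulgA -(mulgA (s i * d)) s_sq mulg1.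
Qed.

(** Exactly one of [y] and [s i * y] is a descent, so one of the two sums survives. When it is the
    one at [s i * y], conjugation by [s i] ([sX]) brings it to the required form. *)
Lemma opL_quad i f :
  opL i (opL i f) = (f + xi *: \sum_(d in X i) opD d (opL i f))%R.
Proof.
apply/ffunP => y; rewrite !ffunE sum_ffunE.
have -> : (\sum_(d in X i) opD d (opL i f) y = \sum_(d in X i) opL i f (d * y)%g)%R.
  rewrite (reindex_inj invg_inj); apply: eq_big => d; first exact: X_inv.
  by rewrite ffunE invgK.
rewrite !mulgA s_sq mul1g sgM sg_s descent_strans -addrA; congr (_ + _)%R.
case: (boolP (dl i y)) => /= d; first by rewrite mul0r mul0r add0r mul1r.
rewrite mul0r mul0r addr0 mul1r sX; congr (_ * _)%R; apply: eq_bigr => e eX.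
by rewrite ffunE (sg_Xl _ eX) (negPf d) mul0r mul0r addr0.
Qed.

Lemma opL_opD i d f : sg d = 1 -> opD d (opL i f) = opL i (opD (s i * d * s i) f).
Proof.
move=> d1; apply/ffunP => y; rewrite !ffunE sgM sgV d1 invg1 mul1g.
have sV : (s i)^-1 = s i by apply: (mulgI (s i)); rewrite mulgV s_sq.
congr (f _ + _ * _)%R; first by rewrite !invMg !mulgA mulgKV sV.
(* The substitution turns [e * d^-1 * y] into [s i * d^-1 * s i * e * y]; it preserves [X i] by
   [X_conj], as [d] lies over the identity. *)
rewrite (reindex_inj (_ : injective (fun e => s i * d^-1 * s i * e * d))) /=; last first.
  by move=> e e' /mulIg/mulgI.
apply: eq_big => [e|e _]; last by rewrite ffunE !invMg sV !mulgA mulgK.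
rewrite -[RHS]X_conj_s -[RHS](@X_conj i i d^-1) ?sgM ?sgV ?d1 ?invg1 ?mul1g ?mulg1 //.
by rewrite invgK !mulgA -(mulgA _ (s i) (s i)) s_sq mulg1.
Qed.

Lemma opD1 f : opD 1 f = f.
Proof. by apply/ffunP => y; rewrite ffunE invg1 mul1g. Qed.

Lemma opDM d d' f : opD d (opD d' f) = opD (d * d') f.
Proof. by apply/ffunP => y; rewrite !ffunE invMg mulgA. Qed.

Definition basis_fun x : V := [ffun y => ((y == x)%:R)%R].

(** If [y] is a descent, so is each [d * y], which then differs from [x]: the sum vanishes. *)
Lemma opL_basis i x : dl i x = false -> opL i (basis_fun x) = basis_fun (s i * x).
Proof.
move=> up; apply/ffunP => y; rewrite !ffunE.
have -> : (y == s i * x) = (s i * y == x).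
  by rewrite -(inj_eq (mulgI (s i))) mulgA s_sq mul1g.
case: (boolP (dl i y)) => [dy|_]; last by rewrite mul0r mul0r addr0.
rewrite big1 ?mulr0 ?addr0 // => d dX; rewrite ffunE.
by case: eqP => // e; move: up; rewrite -e (sg_Xl _ dX) dy.
Qed.

Lemma opD_basis d x : opD d (basis_fun x) = basis_fun (d * x).
Proof.
by apply/ffunP => y; rewrite !ffunE -(inj_eq (mulgI d)) mulKVg.
Qed.

End RegularRepresentation.

(** * Monomial matrices *)

Section MonomialMatrices.
Variables (F : finFieldType) (m : nat).
Local Notation GL := {'GL_m.+1[F]}.
Implicit Types (f g h : 'I_m.+1 -> {unit F}) (w : 'S_m.+1) (i j : 'I_m).

Lemma unitC (c d : {unit F}) : c * d = d * c.
Proof. by apply/val_inj; rewrite !FinRing.val_unitM mulrC. Qed.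

Let unit_cancel (a b c d : {unit F}) : c * a * d^-1 * (d * b * c^-1) = a * b.
Proof. by rewrite !mulgA mulgKV (unitC _ c^-1) !mulgA mulVg mul1g. Qed.

Lemma dmx_is_unit f : diag_mx (\row_j val (f j)) \is a @GRing.unit 'M[F]_m.+1.
Proof.
rewrite [_ \is a _]unitmxE det_diag unitr_prod // => j _.
by rewrite mxE (valP (f j)).
Qed.

Definition dmx f : GL := FinRing.unit _ (dmx_is_unit f).
Definition pmx w : GL := FinRing.unit _ (perm_mx_is_unit F w).

Lemma reflE i : refl F i = pmx (strans i). Proof. by []. Qed.

Lemma eq_dmx f g : f =1 g -> dmx f = dmx g.
Proof. by move=> fg; apply/val_inj; congr diag_mx; apply/rowP => j; rewrite !mxE fg. Qed.

Lemma dmx_inj f g : dmx f = dmx g -> f =1 g.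
Proof.
move=> /(congr1 val) /matrixP e j; have := e j j.
by rewrite /= !mxE eqxx !mulr1n => /val_inj.
Qed.

Lemma dmxM f g : dmx f * dmx g = dmx (fun k => f k * g k).
Proof.
apply/val_inj; rewrite FinRing.val_unitM /= -mulmxE mulmx_diag; congr diag_mx.
by apply/rowP => j; rewrite !mxE -FinRing.val_unitM.
Qed.

Lemma dmx1 : dmx (fun=> 1) = 1.
Proof.
apply/val_inj; rewrite FinRing.val_unit1 /=; apply/matrixP => k l.
by rewrite !mxE.
Qed.

Lemma dmxV f : (dmx f)^-1 = dmx (fun k => (f k)^-1).
Proof.
apply/(mulgI (dmx f)); rewrite mulgV dmxM -dmx1.
by apply: eq_dmx => k; rewrite mulgV.
Qed.

Lemma pmxM w w' : pmx (w * w') = pmx w * pmx w'.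
Proof. by apply/val_inj; rewrite FinRing.val_unitM /= perm_mxM. Qed.

Lemma pmx1 : pmx 1 = 1.
Proof. by apply: (mulgI (pmx 1)); rewrite -pmxM !mulg1. Qed.

Lemma pmxV w : (pmx w)^-1 = pmx w^-1.
Proof. by apply: (mulgI (pmx w)); rewrite -pmxM !mulgV pmx1. Qed.

Lemma pmx_dmx w f : pmx w * dmx f = dmx (f \o w) * pmx w.
Proof.
apply/val_inj; rewrite !FinRing.val_unitM /= -!mulmxE mul_mx_diag mul_diag_mx.
apply/matrixP => k l; rewrite !mxE /=.
by case: eqP => [->|_]; rewrite ?mulr1 ?mul1r ?mulr0 ?mul0r.
Qed.

Lemma dmx_eq_pmx f w : dmx f = pmx w -> w = 1.
Proof.
move=> /(congr1 val) /matrixP e; apply/permP => k; have := e k k.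
rewrite perm1 /= !mxE eqxx mulr1n; case: eqP => // _ /eqP.
by rewrite mulr0n => /eqP h; have := valP (f k); rewrite [\val _]h unitr0.
Qed.

Variable Fb : {group {unit F}}.
Local Notation eps := (unitN1 F ^+ (#|Fb|).-1).
Local Notation Hb := (Hb m Fb).
Local Notation WHb := (WHb m Fb).
Local Notation Xs := (Xs Fb).

(* The sign [(-1)^(b-1)] of [h_{i,j}] lies in [F_b]: for [b] even, [F_b] has an
   element of order 2, which can only be [-1]. *)
Lemma eps_in : eps \in Fb.
Proof.
case: (boolP (odd #|Fb|)) => [od|ev].
  rewrite -(odd_double_half #|Fb|) od add1n /= -mul2n expgM.
  have -> : unitN1 F ^+ 2 = 1; last by rewrite expg1n group1.
  by rewrite expg2; apply/val_inj; rewrite /= mulrNN mulr1.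
have [|x xF ox] := @Cauchy _ 2 Fb isT; first by rewrite dvdn2.
apply: groupX; suff -> : unitN1 F = x by [].
apply/val_inj => /=; have : x ^+ 2 = 1 by rewrite -ox expg_order.
rewrite expg2 => /(congr1 val); rewrite FinRing.val_unitM /= => /eqP.
rewrite -expr2 sqrf_eq1 => /orP[/eqP e|/eqP -> //].
have x1 : x = 1 by apply/val_inj.
by move: ox; rewrite x1 order1.
Qed.

Lemma eps_sq : eps * eps = 1.
Proof.
rewrite -expgMn; last exact: unitC.
have -> : unitN1 F * unitN1 F = 1; last by rewrite expg1n.
by apply/val_inj; rewrite /= mulrNN mulr1.
Qed.

Lemma HbP x : reflect (exists2 f, (forall k, f k \in Fb) & x = dmx f) (x \in Hb).
Proof.
rewrite inE; apply: (iffP andP) => [[/is_diag_mxP dx /forallP hx]|[f fF ->]].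
  have hx' k : exists c, (c \in Fb) && (val x k k == val c).
    by have /existsP[c h] := hx k; exists c.
  exists (fun k => xchoose (hx' k)) => [k|].
    by have /andP[] := xchooseP (hx' k).
  apply/val_inj/matrixP => k l; rewrite !mxE.
  have [<-|ne] := eqVneq k l; last by rewrite dx.
  by have /andP[_ /eqP] := xchooseP (hx' k).
split; first exact: diag_mx_is_diag.
by apply/forallP => k; apply/existsP; exists (f k); rewrite fF /= !mxE eqxx mulr1n.
Qed.

Lemma dmx_in_Hb f : (dmx f \in Hb) = [forall k, f k \in Fb].
Proof.
apply/HbP/forallP => [[g gF e] k|h]; last by exists f.
by rewrite (dmx_inj e).
Qed.

Lemma Hb1 : 1 \in Hb.
Proof. by rewrite -dmx1 dmx_in_Hb; apply/forallP => k; exact: group1. Qed.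

Lemma HbM x y : x \in Hb -> y \in Hb -> x * y \in Hb.
Proof.
move=> /HbP[f fF ->] /HbP[g gF ->]; rewrite dmxM dmx_in_Hb.
by apply/forallP => k; rewrite groupM.
Qed.

Lemma HbV x : x \in Hb -> x^-1 \in Hb.
Proof.
move=> /HbP[f fF ->]; rewrite dmxV dmx_in_Hb.
by apply/forallP => k; rewrite groupV.
Qed.

Lemma HbJ w x : x \in Hb -> pmx w * x * (pmx w)^-1 \in Hb.
Proof.
move=> /HbP[f fF ->]; rewrite pmx_dmx mulgK dmx_in_Hb.
by apply/forallP => k /=.
Qed.

Lemma HbJV w x : x \in Hb -> pmx w^-1 * x * pmx w \in Hb.
Proof. by move=> xH; rewrite -{2}(invgK w) -(pmxV w^-1) HbJ. Qed.

Lemma WpermP x : reflect (exists w, x = pmx w) (x \in Wperm F m).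
Proof.
rewrite inE; apply: (iffP (is_perm_mxP _)) => [[w e]|[w ->]]; exists w => //.
exact/val_inj.
Qed.

Lemma WHbP x : reflect (exists w d, d \in Hb /\ x = pmx w * d) (x \in WHb).
Proof.
apply: (iffP mulsgP) => [[a d /WpermP[w ->] dH ->]|[w [d [dH ->]]]]; first by exists w, d.
by exists (pmx w) d => //; apply/WpermP; exists w.
Qed.

Lemma WHb1 : 1 \in WHb.
Proof. by apply/WHbP; exists 1, 1; rewrite pmx1 mulg1 Hb1. Qed.

Lemma mul_monomial w w' d d' :
  pmx w * d * (pmx w' * d') = pmx (w * w') * (pmx w'^-1 * d * pmx w' * d').
Proof. by rewrite pmxM -pmxV !mulgA (mulgK (pmx w')). Qed.

Lemma WHbM x y : x \in WHb -> y \in WHb -> x * y \in WHb.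
Proof.
move=> /WHbP[w [d [dH ->]]] /WHbP[w' [d' [d'H ->]]]; rewrite mul_monomial.
by apply/WHbP; eexists; eexists; split; last reflexivity; apply: HbM (HbJV _ dH) d'H.
Qed.

Lemma WHbV x : x \in WHb -> x^-1 \in WHb.
Proof.
move=> /WHbP[w [d [dH ->]]]; apply/WHbP; exists w^-1, (pmx w * d^-1 * (pmx w)^-1).
by split; [exact: HbJ (HbV dH) | rewrite invMg -pmxV !mulgA mulVg mul1g].
Qed.

Lemma WHb_mulr x y : y \in WHb -> (x * y \in WHb) = (x \in WHb).
Proof.
move=> yN; apply/idP/idP => [xyN|xN]; last exact: WHbM.
by rewrite -(mulgK y x); exact: WHbM xyN (WHbV yN).
Qed.

Lemma WHb_group_set : group_set WHb.
Proof. by apply/group_setP; split; [exact: WHb1 | exact: WHbM]. Qed.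
Canonical WHb_group := Group WHb_group_set.

Lemma pmx_WHb w : pmx w \in WHb.
Proof. by apply/WHbP; exists w, 1; rewrite mulg1 Hb1. Qed.

Lemma refl_WHb i : refl F i \in WHb.
Proof. exact: pmx_WHb. Qed.

Lemma Hb_WHb d : d \in Hb -> d \in WHb.
Proof. by move=> dH; apply/WHbP; exists 1, d; rewrite pmx1 mul1g. Qed.

(** The counterpart of [wpart] with values in permutations, a morphism on [WHb] by [wpermM]. *)
Definition wperm (x : GL) : 'S_m.+1 := odflt 1 [pick w | (pmx w)^-1 * x \in Hb].

Lemma pmx_coset_inj w w' d : d \in Hb -> (pmx w')^-1 * (pmx w * d) \in Hb -> w' = w.
Proof.
move=> dH h; have := HbM h (HbV dH).
rewrite !mulgA (mulgK d) pmxV -pmxM => /HbP[f _ /esym/dmx_eq_pmx /eqP].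
by rewrite -eq_invg_mul invgK => /eqP.
Qed.

Lemma wpermE w d : d \in Hb -> wperm (pmx w * d) = w.
Proof.
move=> dH; rewrite /wperm; case: pickP => [w' /(pmx_coset_inj dH)|/(_ w)] //.
by rewrite mulKg dH.
Qed.

Lemma wpermM x y : x \in WHb -> y \in WHb -> wperm (x * y) = wperm x * wperm y.
Proof.
move=> /WHbP[w [d [dH ->]]] /WHbP[w' [d' [d'H ->]]]; rewrite !wpermE //.
by rewrite mul_monomial wpermE // HbM ?HbJV.
Qed.

Lemma wpermV x : x \in WHb -> wperm x^-1 = (wperm x)^-1.
Proof.
move=> xN; apply: (mulgI (wperm x)); rewrite -(wpermM xN (WHbV xN)) !mulgV.
by rewrite -pmx1 -(mulg1 (pmx 1)) wpermE // Hb1.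
Qed.

Lemma wperm_pmx w : wperm (pmx w) = w.
Proof. by rewrite -{1}(mulg1 (pmx w)) wpermE // Hb1. Qed.

Lemma wperm_refl i : wperm (refl F i) = strans i.
Proof. exact: wperm_pmx. Qed.

Lemma wperm_Hb d : d \in Hb -> wperm d = 1.
Proof. by move=> dH; rewrite -(mul1g d) -pmx1 wpermE. Qed.

Lemma refl_sq i : refl F i * refl F i = 1.
Proof. by rewrite !reflE -pmxM strans_sq pmx1. Qed.

Lemma reflV i : (refl F i)^-1 = refl F i.
Proof. by rewrite !reflE pmxV stransV. Qed.

Lemma Hb_refl i d : d \in Hb -> refl F i * d * refl F i \in Hb.
Proof. by move=> dH; rewrite -{2}reflV HbJ. Qed.

(** The entries of [h_{i,i+1}], the second one given by its product with the first. This form is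
    symmetric in the two places because the sign lies in [Fb]. *)
Definition Xfun i f : Prop :=
  [/\ f (ileft i) \in Fb, f (ileft i) * f (iright i) = eps
    & forall k, k != ileft i -> k != iright i -> f k = 1].

Lemma hdiagE k c : hdiag k c = dmx (fun l => if l == k then c else 1).
Proof.
apply/val_inj; congr diag_mx; apply/rowP => l; rewrite !mxE.
by case: ifP.
Qed.

Lemma XsP i x : (x \in Xs i) <-> (exists2 f, Xfun i f & x = dmx f).
Proof.
split=> [/imsetP[c cF ->]|[f [f0 f01 f1] ->]].
  rewrite /hdiag2 !hdiagE dmxM; eexists; last reflexivity.
  rewrite -[widen_ord _ _]/(ileft i) -[lift _ _]/(iright i).
  have ne := ileft_neq_iright i; have ne' := ne; rewrite eq_sym in ne'.
  split; rewrite ?eqxx ?(negPf ne) ?(negPf ne') ?mulg1 ?mul1g //.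
    by rewrite unitC mulgKV.
  by move=> k /negPf -> /negPf ->; rewrite mulg1.
apply/imsetP; exists (f (ileft i)) => //; rewrite /hdiag2 !hdiagE dmxM.
apply: eq_dmx => k.
rewrite -[widen_ord _ _]/(ileft i) -[lift _ _]/(iright i).
have [->|k0] := eqVneq k (ileft i).
  by rewrite (negPf (ileft_neq_iright i)) mulg1.
have [->|k1] := eqVneq k (iright i); last by rewrite mulg1 f1.
by rewrite mul1g -f01 (unitC (f (ileft i))) mulgK.
Qed.

Lemma Xs_Hb i x : x \in Xs i -> x \in Hb.
Proof.
move=> /XsP[f [f0 f01 f1] ->]; rewrite dmx_in_Hb; apply/forallP => k.
have [->//|k0] := eqVneq k (ileft i).
have [->|k1] := eqVneq k (iright i); last by rewrite f1 ?group1.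
by rewrite -(groupMl _ f0) f01 eps_in.
Qed.

Lemma Xs_inv i x : (x^-1 \in Xs i) = (x \in Xs i).
Proof.
have imp y : y \in Xs i -> y^-1 \in Xs i.
  move=> /XsP[f [f0 f01 f1] ->]; rewrite dmxV; apply/XsP; eexists; last reflexivity.
  split; first by rewrite groupV.
    rewrite unitC -invMg f01; apply: (mulgI eps); by rewrite mulgV eps_sq.
  by move=> k k0 k1; rewrite f1 ?invg1.
by apply/idP/idP => /imp //; rewrite invgK.
Qed.

(** Write [y = w h] with [w] a permutation and [h] diagonal. The conjugate is diagonal, with the
    entries of [e] moved by [strans i * w] and multiplied by ratios of entries of [h]. These ratios
    are inverse to each other at the two places and 1 elsewhere, so the product of the two entries
    is unchanged. *)
Lemma Xs_conj i j y e : y \in WHb -> wperm (refl F i * y) = wperm (y * refl F j) ->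
  (refl F i * y * e * refl F j * y^-1 \in Xs i) = (e \in Xs j).
Proof.
have imp i' j' y' e' : y' \in WHb -> wperm (refl F i' * y') = wperm (y' * refl F j') ->
    e' \in Xs j' -> refl F i' * y' * e' * refl F j' * y'^-1 \in Xs i'.
  move=> yN; rewrite !wpermM ?refl_WHb // !wperm_refl.
  have /WHbP[w [d [dH ey]]] := yN; rewrite ey wpermE // => sw.
  have /HbP[h hF ed] := dH; rewrite ed => /XsP[f [f0 f01 f1] ->].
  have -> : refl F i' * (pmx w * dmx h) * dmx f * refl F j' * (pmx w * dmx h)^-1 =
     dmx ((fun k => h k * f k * (h (strans j' k))^-1) \o (strans i' * w)).
    transitivity (pmx (strans i' * w) * (dmx h * dmx f) *
        (pmx (strans j') * dmx (fun k => (h k)^-1)) * pmx w^-1).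
      by rewrite invMg !reflE dmxV pmxV pmxM !mulgA.
    rewrite dmxM (pmx_dmx (strans j')) -!mulgA (mulgA (dmx _)) dmxM mulgA pmx_dmx -mulgA -!pmxM.
    by rewrite mulgA sw -(mulgA w) strans_sq mulg1 mulgV pmx1 mulg1.
  have fr : f (iright j') \in Fb by rewrite -(groupMl _ f0) f01 eps_in.
  have wk k : k != ileft i' -> k != iright i' ->
      (strans i' * w) k != ileft j' /\ (strans i' * w) k != iright j'.
    move=> k0 k1; have -> : (strans i' * w) k = w k by rewrite permM tpermD // eq_sym.
    by have [] := strans_conj sw => -[<- <-]; rewrite !(inj_eq perm_inj).
  apply/XsP; eexists; last reflexivity.
  split.
  - rewrite /= permM strans_ileft.
    by have [] := strans_conj sw => -[_ ->];
      rewrite ?strans_ileft ?strans_iright !groupM ?groupV.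
  - rewrite /= !permM strans_ileft strans_iright.
    have [] := strans_conj sw => -[-> ->]; rewrite ?strans_ileft ?strans_iright unit_cancel //.
    by rewrite unitC.
  - move=> k k0 k1; have [l0 l1] := wk k k0 k1; rewrite /=.
    have -> : strans j' ((strans i' * w) k) = (strans i' * w) k by rewrite tpermD // eq_sym.
    by rewrite f1 // mulg1 mulgV.
move=> yN sw; apply/idP/idP; last exact: imp.
move=> dX.
(* The converse is the direct implication with [y] replaced by this element, which carries the
   conjugate back to [e]. *)
have yVN : refl F j * y^-1 * refl F i \in WHb by rewrite !WHbM ?WHbV ?refl_WHb.
have <- : refl F j * (refl F j * y^-1 * refl F i) * (refl F i * y * e * refl F j * y^-1) *
    refl F i * (refl F j * y^-1 * refl F i)^-1 = e.
  rewrite !invMg invgK !reflV !mulgA refl_sq mul1g -(mulgA _ (refl F i) (refl F i)).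
  rewrite refl_sq mulg1 mulVg mul1g -(mulgA _ (refl F i) (refl F i)) refl_sq mulg1.
  by rewrite mulgKV -mulgA refl_sq mulg1.
apply: imp => //.
rewrite !mulgA refl_sq mul1g -(mulgA _ (refl F i) (refl F i)) refl_sq mulg1.
have -> : y^-1 * refl F i = (refl F i * y)^-1 by rewrite invMg reflV.
have -> : refl F j * y^-1 = (y * refl F j)^-1 by rewrite invMg reflV.
by rewrite !wpermV ?WHbM ?refl_WHb // sw.
Qed.

End MonomialMatrices.

(** * Length and coefficients *)

Section Length.
Variables (F : finFieldType) (m : nat) (Fb : {group {unit F}}).
Local Notation GL := {'GL_m.+1[F]}.
Local Notation WHb := (WHb m Fb).
Implicit Types (x y : GL) (s : seq 'I_m) (w : 'S_m.+1).

Lemma wprodE s : wprod F s = pmx F (pword s).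
Proof.
elim: s => [|i s IH]; first by rewrite /wprod /pword !big_nil pmx1.
by rewrite pword_cons pmxM -IH /wprod big_cons.
Qed.

Lemma pmx_inj : injective (@pmx F m).
Proof.
move=> w w' e; apply: (mulgI w'^-1); rewrite mulVg.
by apply: (@dmx_eq_pmx F m (fun=> 1)); rewrite dmx1 pmxM -pmxV e mulVg.
Qed.

Lemma lenW_pmx w : lenW (pmx F w) = inv_number w.
Proof.
rewrite /lenW; case: xgetP => [p _ [[s es <-] h]|h].
  have /pmx_inj ew : pmx F (pword s) = pmx F w by rewrite -wprodE.
  have [u ru eu] := exists_rword w.
  apply/eqP; rewrite eqn_leq -{2}ew inv_number_word andbT -eu (eqP ru).
  by apply: h; rewrite wprodE eu.
have [s rs es] := exists_rword w.
case: (h (inv_number w)); split; first by exists s; rewrite ?wprodE ?es // -es (eqP rs).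
move=> u; rewrite wprodE => /pmx_inj <-; exact: inv_number_word.
Qed.

Lemma wpartE x : x \in WHb -> wpart Fb x = pmx F (wperm Fb x).
Proof.
move=> /WHbP[w [d [dH ->]]]; rewrite wpermE // /wpart.
case: pickP => [y /andP[/WpermP[w' ->] /(pmx_coset_inj dH) ->]|/(_ (pmx F w))] //.
by rewrite mulKg dH andbT => /WpermP[]; exists w.
Qed.

Lemma ellE x : x \in WHb -> ell Fb x = inv_number (wperm Fb x).
Proof. by move=> xN; rewrite /ell wpartE // lenW_pmx. Qed.

Lemma wprod_WHb s : wprod F s \in WHb.
Proof. by rewrite wprodE pmx_WHb. Qed.

Lemma wperm_wprod s : wperm Fb (wprod F s) = pword s.
Proof. by rewrite wprodE wperm_pmx. Qed.

Lemma reducedE s : reduced Fb s <-> rword s.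
Proof.
rewrite /reduced ellE ?wprod_WHb // wperm_wprod.
by split=> [/eqP|/eqP].
Qed.

End Length.

(** * The coefficient ring, positivity and the bar involution *)

Section Coefficients.
Local Open Scope ring_scope.

Lemma A_to_Av_zmod : GRing.zmod_morphism A_to_Av.
Proof. by move=> p q; apply/val_inj; rewrite /= tofracB. Qed.

Lemma A_to_Av_monoid : GRing.monoid_morphism A_to_Av.
Proof. by split=> [|p q]; apply/val_inj; rewrite /= ?tofrac1 ?tofracM. Qed.

HB.instance Definition _ := GRing.isZmodMorphism.Build ringA Av A_to_Av A_to_Av_zmod.
HB.instance Definition _ := GRing.isMonoidMorphism.Build ringA Av A_to_Av A_to_Av_monoid.

Local Notation v := (A_to_Av ind_v).
Local Notation v1 := Av_vinv.

Lemma vK : v * v1 = 1.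
Proof. by apply/val_inj; rewrite /= divff ?ind_v_neq0. Qed.

Lemma Av_gen (c : Av) : exists p k, c = A_to_Av p * v1 ^+ k.
Proof.
have /asboolP[p [k e]] := Av_valP c; exists p, k; apply/val_inj.
rewrite rmorphM rmorphXn /= e; congr (_ * _).
by rewrite exprVn.
Qed.

Lemma A_to_Av_inj : injective A_to_Av.
Proof. by move=> p q /(congr1 Av_val) /= /eqP; rewrite tofrac_eq => /eqP. Qed.

Definition xiAv : Av := A_to_Av ind_a * v1.

(* [p / v^k] takes a positive value at [v = 1], [a = -1], i.e. at [- a / v = 1]. *)
Definition Av_pos (c : Av) : Prop :=
  exists p k, c = A_to_Av p * v1 ^+ k /\ (0 < p.[1].[-1] :> int)%R.

Lemma Av_pos_neq0 c : Av_pos c -> c != 0.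
Proof.
move=> [p [k [-> hp]]]; apply/eqP => e.
have : A_to_Av p = A_to_Av 0.
  rewrite -[LHS]mulr1 -(expr1n _ k) -vK exprMn mulrCA e mulr0.
  by apply/esym; exact: rmorph0.
by move=> /A_to_Av_inj p0; move: hp; rewrite p0 !horner0 ltxx.
Qed.

Lemma Av_pos1 : Av_pos 1.
Proof.
exists 1, 0; split; last by rewrite !hornerE.
by rewrite rmorph1 mulr1.
Qed.

Lemma Av_posD c d : Av_pos c -> Av_pos d -> Av_pos (c + d).
Proof.
move=> [p [k [-> hp]]] [q [l [-> hq]]].
(* Reduction to a common denominator; the added powers of [v] take the value 1 at [v = 1]. *)
exists (p * ind_v ^+ l + q * ind_v ^+ k), (k + l); split; last first.
  by rewrite /ind_v !hornerE !expr1n !hornerE; apply: addr_gt0.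
have vX n : v ^+ n * v1 ^+ n = 1 by rewrite -exprMn vK expr1n.
rewrite rmorphD !rmorphM !rmorphXn exprD mulrDl; congr (_ + _).
  by rewrite -mulrA [v ^+ l * _]mulrCA vX mulr1.
by rewrite [v1 ^+ k * _]mulrC mulrACA vX mulr1.
Qed.

Lemma Av_posX c : Av_pos c -> Av_pos (- xiAv * c).
Proof.
move=> [p [k [-> hp]]]; exists (- ind_a * p), k.+1; split; last first.
  by rewrite /ind_a !hornerE.
by rewrite rmorphM rmorphN exprS /xiAv !mulNr mulrACA.
Qed.

(** A set closed under the operations in [coef], in which a sum vanishes only if every term does. *)
Definition Av_cone (c : Av) : Prop := c = 0 \/ Av_pos c.

Lemma Av_cone_neq0D c d : Av_cone c -> Av_cone d -> (c + d <> 0 <-> c <> 0 \/ d <> 0).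
Proof.
case=> [->|hc] [->|hd]; rewrite ?add0r ?addr0.
- by split=> [|[]].
- by split=> [|[]] // h; right.
- by split=> [|[]] // h; left.
split=> _; first by left; apply/eqP/Av_pos_neq0.
exact/eqP/Av_pos_neq0/Av_posD.
Qed.

Lemma Av_coneD c d : Av_cone c -> Av_cone d -> Av_cone (c + d).
Proof.
case=> [->|hc] [->|hd]; rewrite ?add0r ?addr0; [by left|by right|by right|right].
exact: Av_posD.
Qed.

Lemma Av_coneX c : Av_cone c -> Av_cone (- xiAv * c).
Proof. by case=> [->|hc]; [left; rewrite mulr0|right; apply: Av_posX]. Qed.

Lemma Av_cone_neq0X c : Av_cone c -> (- xiAv * c <> 0 <-> c <> 0).
Proof.
case=> [->|hc]; first by rewrite mulr0.
by split=> _; apply/eqP/Av_pos_neq0 => //; apply: Av_posX.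
Qed.

Lemma Av_cone_sum (I : finType) (P : pred I) (f : I -> Av) :
  (forall i, P i -> Av_cone (f i)) -> Av_cone (\sum_(i | P i) f i).
Proof.
move=> h; elim/big_rec: _ => [|i c Pi hc]; first by left.
by apply: Av_coneD => //; exact: h.
Qed.

Lemma Av_cone_neq0_sum (I : finType) (P : pred I) (f : I -> Av) :
  (forall i, P i -> Av_cone (f i)) ->
  (\sum_(i | P i) f i <> 0 <-> exists2 i, P i & f i <> 0).
Proof.
move=> h; split=> [nz|[i Pi nz]].
  apply: contrapT => nex; apply: nz; apply: big1 => i Pi.
  by apply: contrapT => nz; apply: nex; exists i.
rewrite (bigD1 i) //=; apply/Av_cone_neq0D; [exact: h| |by left].
by apply: Av_cone_sum => j /andP[/h].
Qed.

(** [Av] is generated as a ring by [a], [v] and [v^-1]. This is applied to the square of a bar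
    map. *)
Lemma ring_endo_id (f : Av -> Av) : GRing.zmod_morphism f -> GRing.monoid_morphism f ->
  f v = v -> f (A_to_Av ind_a) = A_to_Av ind_a -> f =1 id.
Proof.
move=> fB [f1 fM] fv fa.
have f0 : f 0 = 0 by rewrite -(subrr 0) fB !subrr.
have fN c : f (- c) = - f c by rewrite -[in LHS](sub0r c) fB f0 sub0r.
have fD c d : f (c + d) = f c + f d by rewrite -{1}(opprK d) fB fN opprK.
have fn (n : nat) : f n%:R = n%:R by elim: n => [|n IH]; rewrite ?mulrS ?fD ?f1 ?IH.
have fz (n : int) : f n%:~R = n%:~R by case: n => n; rewrite ?NegzE ?mulrNz ?fN fn.
have fP (q : {poly int}) : f (A_to_Av q%:P) = A_to_Av q%:P.
  elim/poly_ind: q => [|q n IH]; first by rewrite rmorph0.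
  rewrite polyCD polyCM rmorphD rmorphM fD fM IH -[n]intz !rmorph_int fz.
  by congr (_ * _ + _); exact: fa.
have fA (p : ringA) : f (A_to_Av p) = A_to_Av p.
  elim/poly_ind: p => [|p q IH]; first by rewrite rmorph0.
  by rewrite rmorphD rmorphM fD fM IH fP; congr (_ * _ + _); exact: fv.
have fv1 : f v1 = v1.
  by rewrite -[LHS]mulr1 -vK mulrA -{1}fv -fM [v1 * v]mulrC vK f1 mul1r.
move=> c; have [p [k ->]] := Av_gen c.
rewrite fM fA; congr (_ * _); elim: k => [|k IH]; first by rewrite f1.
by rewrite exprS fM IH fv1.
Qed.

Lemma is_bar_invol f : is_bar f -> f 0 = 0 /\ involutive f.
Proof.
move=> [fB [f1 fM] fv fa]; have f0 : f 0 = 0 by rewrite -(subrr 0) fB !subrr.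
have fN c : f (- c) = - f c by rewrite -[in LHS](sub0r c) fB f0 sub0r.
have fv1 : f v1 = v.
  by rewrite -[LHS]mulr1 -vK [v * v1]mulrC mulrA -{2}fv -fM mulrC [v1 * v]mulrC vK f1 mulr1.
split=> // c; apply: (ring_endo_id (f := f \o f)) => [x y|||] /=.
- by rewrite !fB.
- by split=> [|x y] /=; rewrite ?f1 // !fM.
- by rewrite fv fv1.
rewrite fa fM fN fa expr2 fM fv1 !mulNr opprK -mulrA.
by rewrite mulrACA [v1 * v]mulrC vK !mulr1.
Qed.

(** Either [bar] satisfies [is_bar], or it is the default [id] of [xget]; the claim and [barK] hold
    in both cases. *)
Lemma bar0 : bar 0 = 0.
Proof. by rewrite /bar; case: xgetP => // f -> /is_bar_invol[]. Qed.

Lemma barK : involutive bar.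
Proof. by rewrite /bar; case: xgetP => // f -> /is_bar_invol[]. Qed.

End Coefficients.

(** * The representation of the Hecke algebra *)

Section HeckeRepresentation.
Variables (F : finFieldType) (m : nat) (Fb : {group {unit F}}).
Local Notation WHb := (WHb m Fb).
Local Notation Hb := (Hb m Fb).
Local Notation Xs := (Xs Fb).
Local Notation N := (WHb_group m Fb).
Local Notation hb := (hb m Fb).
Local Notation v := (A_to_Av ind_v).
Local Notation v1 := Av_vinv.
Local Notation V := {ffun subg_of N -> Av^o}.

(** The regular representation is built on a group type where the projection to permutations is
    multiplicative everywhere, hence [subg_of N] rather than all matrices. *)
Definition swperm (y : subg_of N) : 'S_m.+1 := wperm Fb (sgval y).
Definition srefl i : subg_of N := subg N (refl F i).
Definition sXs i : {set subg_of N} := [set y | sgval y \in Xs i].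

Lemma val_srefl i : sgval (srefl i) = refl F i.
Proof. by rewrite subgK // refl_WHb. Qed.

Lemma swpermM : {morph swperm : x y / x * y}.
Proof. by move=> x y; rewrite /swperm sgvalM ?wpermM ?subgP ?inE. Qed.

Lemma swperm_srefl i : swperm (srefl i) = strans i.
Proof. by rewrite /swperm val_srefl wperm_refl. Qed.

Lemma subg_eq (x y : subg_of N) : sgval x = sgval y -> x = y.
Proof. exact: val_inj. Qed.

Lemma srefl_sq i : srefl i * srefl i = 1.
Proof. by apply: subg_eq; rewrite /= !val_srefl refl_sq. Qed.

Lemma srefl_comm (i j : 'I_m) : (i.+1 < j) || (j.+1 < i) ->
  srefl i * srefl j = srefl j * srefl i.
Proof.
move=> ij; apply: subg_eq; rewrite /= !val_srefl !reflE -!pmxM.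
by rewrite strans_comm.
Qed.

Lemma srefl_braid (i j : 'I_m) : j = i.+1 :> nat ->
  srefl i * srefl j * srefl i = srefl j * srefl i * srefl j.
Proof.
move=> ij; apply: subg_eq; rewrite /= !val_srefl !reflE -!pmxM.
by rewrite strans_braid.
Qed.

Lemma swperm_sXs i e : e \in sXs i -> swperm e = 1.
Proof. by rewrite inE => /Xs_Hb /wperm_Hb. Qed.

Lemma sXs_inv i e : (e^-1 \in sXs i) = (e \in sXs i).
Proof. by rewrite !inE /= Xs_inv. Qed.

Lemma sXs_conj i j y e : swperm (srefl i * y) = swperm (y * srefl j) ->
  (srefl i * y * e * srefl j * y^-1 \in sXs i) = (e \in sXs j).
Proof.
move=> h; rewrite !inE /= !val_srefl Xs_conj ?subgP //.
by move: h; rewrite /swperm /= !val_srefl.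
Qed.

Local Notation TL := (@opL _ _ swperm srefl sXs Av xiAv).
Local Notation TD := (@opD _ Av).

(** [TL i] is the operator of [T_s], and [t_s = v T_s]. *)
Definition hecke_act (g : gen m Fb) : V -> V :=
  match g with
  | Gs i => fun f => (v *: TL i f)%R
  | Gd d => TD (subg N (val d))
  end.

Lemma hb_WHb (d : hb) : val d \in WHb.
Proof. exact/Hb_WHb/valP. Qed.

Lemma hecke_act_linear g : linear (hecke_act g).
Proof.
case: g => [i|d] c f g /=; last exact: opD_linear.
by rewrite opL_linear scalerDr !scalerA mulrC.
Qed.

Lemma TL_Z i c f : TL i (c *: f)%R = (c *: TL i f)%R.
Proof.
have h0 : TL i 0%R = 0%R.
  have := opL_linear swperm srefl sXs xiAv i (-1)%R 0%R 0%R.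
  by rewrite scaler0 addr0 scaleN1r addNr.
by have := opL_linear swperm srefl sXs xiAv i c f 0%R; rewrite h0 !addr0.
Qed.

Lemma TD_Z (d : subg_of N) c f : TD d (c *: f)%R = (c *: TD d f)%R.
Proof. by apply/ffunP => y; rewrite !ffunE. Qed.

Lemma sum_hb_sXs i (f : subg_of N -> V) :
  (\sum_(d : hb | val d \in Xs i) f (subg N (val d)) = \sum_(y in sXs i) f y)%R.
Proof.
pose d1 : hb := exist _ 1%g (Hb1 m Fb).
rewrite [RHS](reindex (fun d : hb => subg N (val d))) /=; last first.
  exists (fun y => insubd d1 (sgval y)) => x; rewrite inE => xX.
    by apply: val_inj; rewrite val_insubd subgK ?hb_WHb // (valP x).
  by rewrite val_insubd (Xs_Hb xX) sgvalK.
by apply: eq_bigl => d; rewrite inE subgK // hb_WHb.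
Qed.

Local Notation ev := (peval A_to_Av hecke_act).

Lemma ev_sum (I : finType) (P : pred I) (u : I -> pterm ringA (gen m Fb)) f :
  ev (\big[@PAdd _ _/PCst 0%R]_(i | P i) u i) f = (\sum_(i | P i) ev (u i) f)%R.
Proof.
apply: (big_morph (fun u => ev u f)) => //=.
by rewrite rmorph0 scale0r.
Qed.

Lemma hecke_act_rel u w : hecke_rel u w -> ev u =1 ev w.
Proof.
case=> {u w} /=.
- move=> d -> f; rewrite rmorph1 scale1r.
  have -> : subg N 1 = 1 by apply: subg_eq; rewrite subgK.
  exact: opD1.
- move=> d d' e de f; rewrite opDM; congr (TD _ f); apply: subg_eq.
  by rewrite /= !subgK ?hb_WHb // de.
- move=> d e i ei f; rewrite TD_Z; congr (_ *: _)%R.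
  rewrite (opL_opD swpermM srefl_sq sXs_conj).
    by congr (TL i (TD _ f)); apply: subg_eq; rewrite /= !val_srefl !subgK ?hb_WHb // ei.
  by rewrite /swperm subgK ?hb_WHb // wperm_Hb ?(valP d).
- move=> i j ij f; rewrite !TL_Z; do 2!congr (_ *: _)%R.
  exact: (opL_far swpermM swperm_srefl srefl_sq srefl_comm swperm_sXs sXs_conj).
- move=> i j ij f; rewrite !TL_Z; do 3!congr (_ *: _)%R.
  exact: (opL_braid swpermM swperm_srefl srefl_sq srefl_braid swperm_sXs sXs_conj).
move=> i f; rewrite TL_Z ev_sum /=.
rewrite (opL_quad swpermM swperm_srefl srefl_sq swperm_sXs sXs_inv sXs_conj).
rewrite !scalerDr !scalerA; congr (_ + _)%R; first by rewrite expr2 rmorphM.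
rewrite -(sum_hb_sXs i (fun y => TD y (TL i f))) !scaler_sumr.
apply: eq_bigr => d _; rewrite TD_Z !scalerA; congr (_ *: _)%R.
by rewrite /xiAv [(_ * v1)%R]mulrC !mulrA mulrC -(mulrA _ v) vK mulr1.
Qed.

(** The extension of scalars is again a presented algebra, with every element of [hecke] as a
    generator, so [palg_act] is used a second time on top of this action. *)
Definition hecke_v_act : hecke m Fb -> V -> V :=
  palg_act A_to_Av hecke_act (r := @hecke_rel F m Fb).

Local Notation ev2 := (peval (@idfun Av) hecke_v_act).

Lemma tens_act_rel u w : tens_rel u w -> ev2 u =1 ev2 w.
Proof.
case=> {u w} [|y z|y z|c y] f /=; rewrite /hecke_v_act.
- by rewrite (palg_act1 hecke_act_linear hecke_act_rel) scale1r.
- exact: (palg_actD hecke_act_linear hecke_act_rel).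
- exact: (palg_actM hecke_act_linear hecke_act_rel).
exact: (palg_actZ hecke_act_linear hecke_act_rel).
Qed.

Lemma hecke_v_act_linear y : linear (hecke_v_act y).
Proof. by move=> c f g; apply: (palg_act_linear _ hecke_act_linear). Qed.

End HeckeRepresentation.

(** * The bar conjugates of the basis elements *)

Section HeckeAlgebra.
Variables (F : finFieldType) (m : nat) (Fb : {group {unit F}}).
Local Notation GL := {'GL_m.+1[F]}.
Local Notation WHb := (WHb m Fb).
Local Notation Hb := (Hb m Fb).
Local Notation Xs := (Xs Fb).
Local Notation N := (WHb_group m Fb).
Local Notation hb := (hb m Fb).
Local Notation v := (A_to_Av ind_v).
Local Notation v1 := Av_vinv.
Local Notation H := (hecke m Fb).
Local Notation Hv := (hecke_v m Fb).
Local Notation T := (T_basis Fb).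
Local Notation r := (refl F).
Implicit Types (s u : seq 'I_m) (x y d e : GL) (i j : 'I_m).
Local Open Scope ring_scope.
Local Open Scope quotient_scope.

Definition tens (y : H) : Hv := palg_gen (@tens_rel F m Fb) y.
Definition gs i : H := palg_gen (@hecke_rel F m Fb) (Gs Fb i).
Definition gd (d : hb) : H := palg_gen (@hecke_rel F m Fb) (Gd d).

Lemma tensM (y z : H) : tens (y * z) = tens y * tens z.
Proof. by rewrite -[RHS]pi_palgM; apply/palgE/pcong_rel/tens_mul. Qed.

Lemma tensD (y z : H) : tens (y + z) = tens y + tens z.
Proof. by rewrite -[RHS]pi_palgD; apply/palgE/pcong_rel/tens_add. Qed.

Lemma tens1 : tens 1 = 1.
Proof. by apply/palgE/pcong_rel/tens_one. Qed.

Lemma tensZ c (y : H) : tens (c *: y) = A_to_Av c *: tens y.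
Proof.
transitivity (\pi_(palg (@tens_rel F m Fb)) (PCst (A_to_Av c) * PGen y)%P : Hv).
  exact/palgE/pcong_rel/tens_scale.
by rewrite pi_palgM pi_palg_cst -palg_scaleAl mul1r.
Qed.

Lemma tens0 : tens 0 = 0.
Proof. by apply: (addrI (tens 0)); rewrite -tensD !addr0. Qed.

Lemma tens_sum (I : finType) (P : pred I) (f : I -> H) :
  tens (\sum_(i | P i) f i) = \sum_(i | P i) tens (f i).
Proof. by apply: (big_morph tens); [exact: tensD | exact: tens0]. Qed.

Lemma gd1 (d : hb) : val d = 1%g -> gd d = 1.
Proof. by move=> d1; apply/palgE/pcong_rel/hecke_one. Qed.

Lemma gdM (d d' e : hb) : val e = (val d * val d')%g -> gd d * gd d' = gd e.
Proof. by move=> h; rewrite -[LHS]pi_palgM; apply/palgE/pcong_rel/hecke_dd. Qed.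

Lemma gd_gs (d e : hb) i : val e = (r i * val d * r i)%g -> gd d * gs i = gs i * gd e.
Proof. by move=> h; rewrite -[LHS]pi_palgM -[RHS]pi_palgM; apply/palgE/pcong_rel/hecke_ds. Qed.

Lemma gs_comm i j : (i.+1 < j)%N || (j.+1 < i)%N -> gs i * gs j = gs j * gs i.
Proof. by move=> h; rewrite -[LHS]pi_palgM -[RHS]pi_palgM; apply/palgE/pcong_rel/hecke_comm. Qed.

Lemma gs_braid i j : j = i.+1 :> nat -> gs i * gs j * gs i = gs j * gs i * gs j.
Proof.
move=> h; rewrite -[gs i * gs j]pi_palgM -[gs j * gs i]pi_palgM.
by rewrite -[LHS]pi_palgM -[RHS]pi_palgM; apply/palgE/pcong_rel/hecke_braid.
Qed.

Lemma gs_quad i :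
  gs i * gs i = ind_v ^+ 2 *: (1 : H) + ind_a *: \sum_(d : hb | val d \in Xs i) gd d * gs i.
Proof.
have /palgE := pcong_rel (@hecke_quad F m Fb i).
rewrite !pi_palgD !pi_palgM !pi_palg_cst pi_palg_sum.
rewrite -[LHS]/(gs i * gs i) => ->; rewrite -palg_scaleAl mul1r; congr (_ + _ *: _).
by apply: eq_bigr => d _; rewrite pi_palgM.
Qed.

Definition Ts i : Hv := v1 *: tens (gs i).
(** Extended by 0 to all matrices, so that products can serve as indices without membership
    proofs. *)
Definition Td d : Hv := if insub d is Some d' then tens (gd d') else 0.

Lemma Td_val (d : hb) : Td (val d) = tens (gd d).
Proof. by rewrite /Td valK. Qed.

Lemma TdE d (dH : d \in Hb) : Td d = tens (gd (exist _ d dH)).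
Proof. exact: (Td_val (exist _ d dH)). Qed.

Lemma Td1 : Td 1%g = 1.
Proof. by rewrite (TdE (Hb1 m Fb)) gd1 ?tens1. Qed.

Lemma TdM d e : d \in Hb -> e \in Hb -> Td d * Td e = Td (d * e)%g.
Proof.
move=> dH eH; have deH := HbM dH eH.
by rewrite (TdE dH) (TdE eH) (TdE deH) -tensM; congr tens; apply: gdM.
Qed.

Lemma Td_Ts d i : d \in Hb -> Td d * Ts i = Ts i * Td (r i * d * r i)%g.
Proof.
move=> dH; have eH := Hb_refl i dH.
rewrite (TdE dH) (TdE eH) -palg_scaleAr -palg_scaleAl -!tensM.
by rewrite (@gd_gs (exist _ d dH) (exist (fun x => x \in Hb) _ eH) i).
Qed.

Lemma Ts_comm i j : (i.+1 < j)%N || (j.+1 < i)%N -> Ts i * Ts j = Ts j * Ts i.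
Proof. by move=> h; rewrite !palg_scaleM -!tensM gs_comm. Qed.

Lemma Ts_braid i j : j = i.+1 :> nat -> Ts i * Ts j * Ts i = Ts j * Ts i * Ts j.
Proof. by move=> h; rewrite !palg_scaleM -!tensM gs_braid. Qed.

Lemma Ts_quad i : Ts i * Ts i = 1 + xiAv *: \sum_(d in Xs i) Td d * Ts i.
Proof.
rewrite palg_scaleM -tensM gs_quad tensD !tensZ tens1 tens_sum scalerDr !scalerA.
congr (_ + _).
  rewrite rmorphXn expr2 mulrACA [v1 * v]mulrC vK mulr1.
  exact: scale1r.
have -> : \sum_(d in Xs i) Td d * Ts i = \sum_(d : hb | val d \in Xs i) Td (val d) * Ts i.
  have d1 : hb := exist _ 1%g (Hb1 m Fb).
  rewrite (reindex (fun d : hb => val d)) //; exists (insubd d1) => d dX.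
    by rewrite valKd.
  by rewrite insubdK // unfold_in (Xs_Hb dX).
rewrite [v1 * v1 * _]mulrC mulrA -/xiAv -scalerA; congr (_ *: _).
rewrite scaler_sumr; apply: eq_bigr => d _.
by rewrite Td_val tensM palg_scaleAr.
Qed.

Definition TX i : Hv := \sum_(d in Xs i) Td d.

(** Conjugation by [r i] permutes [Xs i]. This makes the left inverse [TsV i] two-sided. *)
Lemma TX_Ts i : TX i * Ts i = Ts i * TX i.
Proof.
rewrite mulr_suml mulr_sumr [RHS](reindex_inj (_ : injective (fun d => r i * d * r i)%g)) /=;
  last by move=> d e /mulIg/mulgI.
apply: eq_big => [d|d /Xs_Hb dH]; last by rewrite Td_Ts.
have := @Xs_conj F m Fb i i 1%g d (WHb1 m Fb).
by rewrite invg1 !mulg1 mul1g => ->.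
Qed.

Definition TsV i : Hv := Ts i - xiAv *: TX i.

Lemma TsVK i : TsV i * Ts i = 1.
Proof.
rewrite mulrBl Ts_quad -palg_scaleAl mulr_suml; exact: addrK.
Qed.

Lemma TsKV i : Ts i * TsV i = 1.
Proof.
by rewrite mulrBr -(palg_scaleAr xiAv) -TX_Ts palg_scaleAl -mulrBl TsVK.
Qed.

Definition Tw s : Hv := \prod_(i <- s) Ts i.

Lemma Td_Tw d s : d \in Hb ->
  Td d * Tw s = Tw s * Td ((wprod F s)^-1 * d * wprod F s)%g.
Proof.
rewrite /Tw; elim: s d => [|i s IH] d dH.
  by rewrite /wprod !big_nil mul1r mulr1 invg1 mul1g mulg1.
rewrite /wprod !big_cons mulrA Td_Ts // -!mulrA IH ?Hb_refl // /wprod.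
by rewrite invMg reflV !mulgA.
Qed.

Lemma tens_prod s : v1 ^+ size s *: tens (\prod_(i <- s) gs i) = Tw s.
Proof.
rewrite /Tw; elim: s => [|i s IH]; first by rewrite !big_nil tens1 scale1r.
by rewrite !big_cons -IH palg_scaleM -tensM exprS.
Qed.

Lemma wprod_Hb_inj s u d e : d \in Hb -> e \in Hb ->
  (wprod F s * d = wprod F u * e)%g -> pword s = pword u /\ d = e.
Proof.
move=> dH eH h; have hw : pword s = pword u.
  by have := congr1 (wperm Fb) h; rewrite !wprodE !wpermE.
by split=> //; move: h; rewrite !wprodE hw => /mulgI.
Qed.

(** The description in [t_basis] may select another reduced word; Matsumoto's theorem for the [Ts i]
    shows that the product is the same. *)
Lemma T_word s d : rword s -> d \in Hb -> T (wprod F s * d)%g = Tw s * Td d.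
Proof.
move=> rs dH; rewrite /T_basis ellE; last first.
  exact: WHbM (wprod_WHb _ _) (Hb_WHb dH).
rewrite wprodE wpermE // -wprodE /t_basis; case: xgetP => [y _ [u [e [ru ex ->]]]|no].
  have [eu ed] := wprod_Hb_inj dH (valP e) ex.
  have /reducedE ru' := ru.
  have -> : inv_number (pword s) = size u by rewrite eu; exact/eqP.
  rewrite -/(tens _) tensM palg_scaleAl tens_prod ed Td_val; congr (_ * _).
  by apply: matsumoto => //; [exact: Ts_comm | exact: Ts_braid].
case: (no ((\prod_(i <- s) gs i) * gd (exist _ d dH))).
by exists s, (exist _ d dH); split=> //; apply/reducedE.
Qed.

Lemma WHb_word x : x \in WHb -> exists s d, [/\ rword s, d \in Hb & x = (wprod F s * d)%g].
Proof.
move=> /WHbP[w [d [dH ->]]]; have [s rs es] := exists_rword w.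
by exists s, d; split=> //; rewrite wprodE es.
Qed.

Lemma wprod_rev s : wprod F (rev s) = (wprod F s)^-1%g.
Proof. by rewrite !wprodE pword_rev pmxV. Qed.

Lemma wprod_rcons s i : wprod F (rcons s i) = (wprod F s * r i)%g.
Proof. by rewrite /wprod -cats1 big_cat big_seq1. Qed.

Definition TwV s : Hv := \prod_(i <- s) TsV i.

Lemma Tw_rev_TwV s : Tw (rev s) * TwV s = 1 /\ TwV s * Tw (rev s) = 1.
Proof.
rewrite /Tw /TwV; elim: s => [|i s [IH1 IH2]]; first by rewrite !big_nil mulr1.
rewrite rev_cons -cats1 big_cat big_seq1 big_cons /=.
split; first by rewrite -mulrA [Ts i * _]mulrA TsKV mul1r.
by rewrite -mulrA [\prod_(i <- s) _ * _]mulrA IH2 mul1r TsVK.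
Qed.

(** With [w = wprod F s], the inverse of [w d] is [d^-1 w^-1], so its [T] is [Td d^-1] times the
    product along the reversed word. Inverting restores the order of the letters. *)
Lemma barT_word s d : rword s -> d \in Hb -> barT Fb (wprod F s * d)%g = TwV s * Td d.
Proof.
move=> rs dH; have dVH := HbV dH.
have eT : T (wprod F s * d)^-1%g = Td d^-1%g * Tw (rev s).
  rewrite Td_Tw // -T_word ?rword_rev //; last first.
    by rewrite wprodE pmxV HbJV.
  by rewrite wprod_rev invMg !mulgA mulgV mul1g.
have [h1 h2] := Tw_rev_TwV s.
have i1 : (TwV s * Td d) * (Td d^-1%g * Tw (rev s)) = 1.
  by rewrite mulrA -(mulrA (TwV s)) TdM // mulgV Td1 mulr1.
have i2 : (Td d^-1%g * Tw (rev s)) * (TwV s * Td d) = 1.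
  by rewrite mulrA -(mulrA (Td _)) h1 mulr1 TdM // mulVg Td1.
rewrite /barT eT; case: xgetP => [y _ [y1 _]|no].
  by rewrite -[LHS]mulr1 -i2 mulrA y1 mul1r.
by case: (no (TwV s * Td d)).
Qed.

Definition rdescent i x := descent i (wperm Fb x)^-1%g.

Lemma T_Td x d : x \in WHb -> d \in Hb -> T x * Td d = T (x * d)%g.
Proof.
move=> /WHb_word[s [e [rs eH ->]]] dH.
by rewrite -mulgA !T_word ?HbM // -mulrA TdM.
Qed.

Lemma T_Ts_up x i : x \in WHb -> ~~ rdescent i x -> T x * Ts i = T (x * r i)%g.
Proof.
move=> /WHb_word[s [e [rs eH ->]]]; rewrite /rdescent wprodE wpermE // -wprodE => up.
have -> : (wprod F s * e * r i = wprod F (rcons s i) * (r i * e * r i))%g.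
  by rewrite wprod_rcons !mulgA -(mulgA _ (r i) (r i)) refl_sq mulg1.
rewrite !T_word ?rword_rcons ?rs ?Hb_refl // -mulrA Td_Ts // mulrA.
by rewrite /Tw -cats1 big_cat big_seq1.
Qed.

Lemma rdescent_refl x i : x \in WHb -> rdescent i (x * r i)%g = ~~ rdescent i x.
Proof.
by move=> xN; rewrite /rdescent wpermM ?refl_WHb // wperm_refl invMg stransV descent_strans.
Qed.

Lemma rdescent_Hb x i d : x \in WHb -> d \in Hb -> rdescent i (x * d)%g = rdescent i x.
Proof. by move=> xN dH; rewrite /rdescent (wpermM xN (Hb_WHb dH)) (wperm_Hb dH) mulg1. Qed.

Lemma T_TsV x i : x \in WHb -> T x * TsV i =
  T (x * r i)%g + (~~ rdescent i x)%:R *: (- xiAv *: \sum_(d in Xs i) T (x * d)%g).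
Proof.
move=> xN; case: (boolP (rdescent i x)) => [dn|up].
  have xrN := WHbM xN (refl_WHb Fb i).
  have := @T_Ts_up (x * r i)%g i xrN; rewrite rdescent_refl // dn.
  rewrite -mulgA refl_sq mulg1 => <- //; by rewrite -mulrA TsKV mulr1 scale0r addr0.
rewrite mulrBr T_Ts_up // scale1r scaleNr -palg_scaleAr mulr_sumr; congr (_ - _ *: _).
by apply: eq_bigr => d /Xs_Hb dH; rewrite T_Td.
Qed.

(* The word is read from its last letter, so that [coef (rev s)] holds the
   coordinates of the bar conjugate of [T_w] for [s] a reduced word of [w]. *)
Fixpoint coef s x : Av :=
  if s is i :: s' then
    coef s' (x * r i)%g + (~~ rdescent i x)%:R * (- xiAv * \sum_(d in Xs i) coef s' (x * d)%g)
  else (x == 1%g)%:R.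

Lemma TwV_coef s : TwV s = \sum_(x in WHb) coef (rev s) x *: T x.
Proof.
rewrite /TwV; elim/last_ind: s => [|s i IH].
  rewrite big_nil (bigD1 1%g) ?WHb1 //= eqxx scale1r big1 ?addr0 => [|x /andP[_ /negPf ->]].
    have := @T_word [::] 1%g; rewrite /rword /pword /wprod /Tw !big_nil inv_number1.
    by rewrite Td1 mulr1 mulg1 => -> //; exact: Hb1.
  by rewrite scale0r.
rewrite -cats1 big_cat big_seq1 /= IH rev_cat /= mulr_suml.
under [LHS]eq_bigr => x xN do rewrite -palg_scaleAl T_TsV // scalerDr.
under [RHS]eq_bigr => x xN do rewrite scalerDl.
rewrite !big_split /=; congr (_ + _).
  rewrite [RHS](reindex_inj (mulIg (r i))) /=; apply: eq_big => [x|x _].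
    by rewrite (WHb_mulr x (refl_WHb Fb i)).
  by rewrite -mulgA refl_sq mulg1.
under [LHS]eq_bigr => x xN do rewrite !scalerA scaler_sumr.
rewrite exchange_big /=.
under [RHS]eq_bigr => x xN do rewrite mulrA mulr_sumr scaler_suml.
(* Right multiplication by [d] moves the term at [x] to [x * d], so the coordinate at [x] comes from
   [x * d^-1]; the inverse is absorbed since [Xs i] is closed under it. *)
rewrite [RHS]exchange_big /= [RHS](reindex_inj invg_inj) /=.
apply: eq_big => [d|d dX]; first by rewrite Xs_inv.
have dH := Xs_Hb dX.
rewrite [RHS](reindex_inj (mulIg d)) /=; apply: eq_big => [x|x xN].
  by rewrite (WHb_mulr x (Hb_WHb dH)).
by rewrite (mulgK d x) rdescent_Hb //; congr (_ *: _); rewrite mulrC.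
Qed.

Lemma barT_coef s d : rword s -> d \in Hb ->
  barT Fb (wprod F s * d)%g = \sum_(x in WHb) coef (rev s) (x * d^-1)%g *: T x.
Proof.
move=> rs dH; rewrite barT_word // TwV_coef mulr_suml.
rewrite [RHS](reindex_inj (mulIg d)) /=; apply: eq_big => [x|x xN].
  by rewrite (WHb_mulr x (Hb_WHb dH)).
by rewrite (mulgK d x) -palg_scaleAl (T_Td xN dH).
Qed.

Local Notation e_ := (@basis_fun _ Av).
Local Notation act := (palg_act (@idfun Av) (@hecke_v_act F m Fb) (r := @tens_rel F m Fb)).
Local Notation hl := (@hecke_v_act_linear F m Fb).
Local Notation hr := (@tens_act_rel F m Fb).

Lemma act_tens (y : H) f : act (tens y) f = hecke_v_act y f.
Proof. exact: (palg_act_gen hl hr). Qed.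

(** Read from the right, each letter of a reduced word acts at an ascent, where [opL_basis] is left
    translation. The images of the basis function at 1 then separate the [T x] in [T_free]. *)
Lemma act_T x : x \in WHb -> act (T x) (e_ 1%g) = e_ (subg N x).
Proof.
move=> /WHb_word[s [d [rs dH ->]]]; rewrite T_word // (palg_actM hl hr).
have -> : act (Td d) (e_ 1%g) = e_ (subg N d).
  rewrite (TdE dH) act_tens [LHS](palg_act_gen (@hecke_act_linear F m Fb) (@hecke_act_rel F m Fb)).
  by rewrite /= opD_basis mulg1.
rewrite /Tw; elim: s rs => [|i s IH]; first by rewrite /wprod !big_nil mul1g (palg_act1 hl hr).
rewrite rword_cons => /andP[rs up]; rewrite big_cons (palg_actM hl hr) (IH rs).
rewrite (palg_actZ hl hr) act_tens.
rewrite [hecke_v_act _ _](palg_act_gen (@hecke_act_linear F m Fb) (@hecke_act_rel F m Fb)) /=.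
rewrite scalerA mulrC vK scale1r.
have dN : (wprod F s * d)%g \in WHb := WHbM (wprod_WHb Fb s) (Hb_WHb dH).
rewrite (opL_basis (@swpermM F m Fb) (@srefl_sq F m Fb) (@swperm_sXs F m Fb)).
  by rewrite /wprod big_cons -mulgA (subgM (refl_WHb Fb i) dN).
by rewrite /swperm subgK // wprodE wpermE //; apply: negbTE.
Qed.

Lemma T_free (c : GL -> Av) : \sum_(x in WHb) c x *: T x = 0 ->
  forall x, x \in WHb -> c x = 0.
Proof.
move=> h x xN; have := congr1 (fun z => act z (e_ 1%g) (subg N x)) h.
rewrite (palg_act_sum hl hr) (palg_act0 hl hr) sum_ffunE ffunE.
rewrite (bigD1 x) //= big1 => [|y /andP[yN ne]]; rewrite (palg_actZ hl hr) act_T // !ffunE.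
  by rewrite eqxx addr0 => <-; rewrite /GRing.scale /= mulr1.
rewrite -(inj_eq val_inj) /= ?subgK // eq_sym (negPf ne).
by rewrite /GRing.scale /= mulr0.
Qed.

Lemma Rstar_barT y : y \in WHb -> barT Fb y = \sum_(x in WHb) bar (Rstar Fb x y) *: T x.
Proof.
rewrite /Rstar; case: xgetP => [R _ h|no]; first exact: h.
have ex y' : exists c : GL -> Av, y' \in WHb -> barT Fb y' = \sum_(x in WHb) c x *: T x.
  case: (boolP (y' \in WHb)) => [/WHb_word[s [d [rs dH ->]]]|_]; last by exists (fun=> 0).
  by eexists => _; exact: barT_coef.
have [c hc] := choice ex.
(* [bar] is an involution, so conjugating the coordinates [c] yields a family of the kind described
   by [Rstar]. *)
case: (no (fun x y => bar (c y x))) => y' y'N; rewrite hc //.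
by apply: eq_bigr => x _; rewrite barK.
Qed.

(** Coordinates are unique by [T_free], and [bar] vanishes only at 0. *)
Lemma rleqE s d x : rword s -> d \in Hb -> x \in WHb ->
  rleq Fb x (wprod F s * d)%g <-> coef (rev s) (x * d^-1)%g <> 0.
Proof.
move=> rs dH xN; rewrite /rleq; set y := (_ * d)%g.
have yN : y \in WHb := WHbM (wprod_WHb Fb s) (Hb_WHb dH).
have -> : coef (rev s) (x * d^-1)%g = bar (Rstar Fb x y).
  apply/eqP; rewrite -subr_eq0; apply/eqP.
  apply: (T_free (c := fun x => coef (rev s) (x * d^-1)%g - bar (Rstar Fb x y))) => //.
  under eq_bigr do rewrite scalerBl.
  by rewrite sumrB -Rstar_barT // barT_coef // subrr.
split=> h e; apply: h; last by rewrite e bar0.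
by rewrite -(barK (Rstar Fb x y)) e bar0.
Qed.

End HeckeAlgebra.

(** * Distinguished subexpressions *)

Section DistinguishedPaths.
Variables (F : finFieldType) (m : nat) (Fb : {group {unit F}}).
Local Notation GL := {'GL_m.+1[F]}.
Local Notation WHb := (WHb m Fb).
Local Notation Hb := (Hb m Fb).
Local Notation Xs := (Xs Fb).
Local Notation r := (refl F).
Local Notation coef := (coef Fb).
Implicit Types (s u : seq 'I_m) (x y d e : GL) (i j : 'I_m).

Lemma coef_cone s x : Av_cone (coef s x).
Proof.
elim: s x => [|i s IH] x /=; first by case: eqP => _; [right; exact: Av_pos1 | left].
apply: Av_coneD => //; case: (~~ _); last by left; rewrite mul0r.
by rewrite mul1r; apply/Av_coneX/Av_cone_sum => d _.
Qed.

(** All terms of the recursion lie in [Av_cone], so nothing cancels and a single nonzero term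
    suffices. *)
Lemma coef_cons_neq0 i s x : coef (i :: s) x <> 0%R <->
  coef s (x * r i) <> 0%R \/
  (~~ rdescent Fb i x /\ exists2 d, d \in Xs i & coef s (x * d) <> 0%R).
Proof.
have cone_sum : Av_cone (\sum_(d in Xs i) coef s (x * d)%g)%R.
  by apply: Av_cone_sum => d _; exact: coef_cone.
rewrite /=; case: (~~ _); last by rewrite mul0r addr0; split=> [|[|[]]] // h; left.
rewrite mul1r.
have h1 := Av_cone_neq0D (coef_cone s (x * r i)) (Av_coneX cone_sum).
have h2 := Av_cone_neq0X cone_sum.
have h3 := Av_cone_neq0_sum (P := fun d => d \in Xs i) (fun d _ => coef_cone s (x * d)).
split=> [/h1[h|/h2/h3 h]|[h|[_ /h3/h2 h]]]; first by left.
- by right.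
- by apply/h1; left.
by apply/h1; right.
Qed.

Lemma coef_wprod s : coef (rev s) (wprod F s) <> 0%R.
Proof.
elim/last_ind: s => [|s i IH]; first by rewrite /wprod big_nil /= eqxx; apply/eqP/oner_neq0.
rewrite rev_rcons; apply/coef_cons_neq0; left.
by rewrite wprod_rcons -mulgA refl_sq mulg1.
Qed.

Lemma Xs_WHb i d : d \in Xs i -> d \in WHb.
Proof. by move=> /Xs_Hb /Hb_WHb. Qed.

Lemma WHb_refl x i : x \in WHb -> x * r i \in WHb.
Proof. by move=> xN; exact: WHbM xN (refl_WHb Fb i). Qed.

Lemma ell_Hb x d : x \in WHb -> d \in Hb -> ell Fb (x * d) = ell Fb x.
Proof.
move=> xN dH; have dN := Hb_WHb dH.
by rewrite !ellE ?WHbM // (wpermM xN dN) (wperm_Hb dH) mulg1.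
Qed.

Lemma ell_refl x i : x \in WHb ->
  ell Fb (x * r i) = if rdescent Fb i x then (ell Fb x).-1 else (ell Fb x).+1.
Proof.
move=> xN; rewrite !ellE ?WHb_refl // (wpermM xN (refl_WHb Fb i)) wperm_refl.
exact: inv_number_mulr.
Qed.

Lemma ell_gt0 x i : x \in WHb -> rdescent Fb i x -> 0 < ell Fb x.
Proof. by move=> xN dn; rewrite ellE // -inv_numberV -(inv_number_down dn). Qed.

(** Each letter changes the length by at most one, and elements of [Xs i] leave it alone. *)
Lemma ell_coef s x : x \in WHb -> coef s x <> 0%R -> ell Fb x <= size s.
Proof.
elim: s x => [|i s IH] x xN.
  rewrite /=; case: eqP => [->|] // _.
  by rewrite ellE ?WHb1 // (wperm_Hb (Hb1 m Fb)) inv_number1.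
move=> /coef_cons_neq0[/(IH _ (WHb_refl i xN))|[_ [d dX /IH]]] /=.
  by rewrite ell_refl //; case: ifP => _; lia.
rewrite WHbM ?(Xs_WHb dX) // ell_Hb ?(Xs_Hb dX) // => /(_ isT).
by lia.
Qed.

Lemma rleq_refl x : x \in WHb -> rleq Fb x x.
Proof.
move=> xN; have [s [d [rs dH ex]]] := WHb_word xN.
rewrite {2}ex; apply/rleqE => //; rewrite ex (mulgK d); exact: coef_wprod.
Qed.

Lemma rleq_ell x y : x \in WHb -> y \in WHb -> rleq Fb x y -> ell Fb x <= ell Fb y.
Proof.
move=> xN /WHb_word[s [d [rs dH ->]]] /(rleqE rs dH xN).
have dVH := HbV dH.
move=> /ell_coef; rewrite (WHbM xN (Hb_WHb dVH)) size_rev => /(_ isT).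
rewrite (ell_Hb xN dVH) (ell_Hb (wprod_WHb _ _) dH) (ellE (wprod_WHb _ _)).
by rewrite wperm_wprod (eqP rs).
Qed.

Lemma rleq_up x d i : x \in WHb -> ~~ rdescent Fb i x -> d \in Xs i ->
  rleq Fb (x * d) (x * r i).
Proof.
move=> xN up dX; have [s [h [rs hH ex]]] := WHb_word xN.
have dN := Xs_WHb dX; have dH := Xs_Hb dX.
have h'H := Hb_refl i hH.
have -> : x * r i = wprod F (rcons s i) * (r i * h * r i).
  by rewrite ex wprod_rcons !mulgA -(mulgA _ (r i) (r i)) refl_sq mulg1.
have rs' : rword (rcons s i).
  by rewrite rword_rcons rs; move: up; rewrite /rdescent ex wprodE wpermE.
apply/rleqE; rewrite ?(WHbM xN dN) // rev_rcons; apply/coef_cons_neq0; right.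
(* With [x = w h], dividing [x * d] by the diagonal part of [x * r i] leaves [w e]; the step by
   [e^-1] then ends at [w], where the coefficient is nonzero. *)
pose e := h * d * (r i * h * r i)^-1.
have eX : e \in Xs i.
  have rhN : r i * h \in WHb by exact: WHbM (refl_WHb Fb i) (Hb_WHb hH).
  have := @Xs_conj F m Fb i i (r i * h) d rhN.
  rewrite invMg !mulgA refl_sq mul1g (wperm_Hb hH) (wperm_Hb h'H) => /(_ erefl).
  by rewrite dX /e !invMg !reflV !mulgA.
split; first by rewrite rdescent_Hb ?(WHbM xN dN) // ?HbV // rdescent_Hb.
exists e^-1; first by rewrite Xs_inv.
have -> : x * d * (r i * h * r i)^-1 * e^-1 = wprod F s; last exact: coef_wprod.
by rewrite ex /e -!(mulgA (wprod F s)) mulgV mulg1.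
Qed.

Definition dstep i x x' : Prop :=
  x^-1 * x' \in r i |: Xs i /\ rleq Fb x' (x * r i).

Lemma dstepP i x x' : x \in WHb ->
  dstep i x x' <->
  x' = x * r i \/ (~~ rdescent Fb i x /\ exists2 d, d \in Xs i & x' = x * d).
Proof.
move=> xN; have xrN := WHb_refl i xN.
split=> [[/setU1P[e|dX] le]|[->|[up [d dX ->]]]].
- by left; rewrite -e (mulKVg x).
- right; split; last by exists (x^-1 * x'); rewrite // (mulKVg x).
  (* [x'] has the length of [x], while [x * r i] would be shorter. *)
  apply/negP => dn; move: le; rewrite -(mulKVg x x') => le.
  have := rleq_ell (WHbM xN (Xs_WHb dX)) xrN le.
  rewrite (ell_Hb xN (Xs_Hb dX)) ell_refl // dn.
  by have := ell_gt0 xN dn; lia.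
- by split; [rewrite (mulKg x) setU11 | exact: rleq_refl].
by split; [rewrite (mulKg x) setU1r | exact: rleq_up].
Qed.

(** [coef] recurses from the end point back to its predecessor, whereas [dstep] goes forward:
    reversing a step replaces [d] by [d^-1] and does not affect the ascent. *)
Lemma coef_rcons_step s i x' : x' \in WHb ->
  coef (rev (rcons s i)) x' <> 0%R <->
  exists x, [/\ x \in WHb, coef (rev s) x <> 0%R & dstep i x x'].
Proof.
move=> xN; rewrite rev_rcons; split=> [/coef_cons_neq0[h|[up [d dX h]]]|[x [xN' h]]].
- have xrN := WHb_refl i xN.
  exists (x' * r i); split=> //; apply/dstepP => //.
  by left; rewrite -mulgA refl_sq mulg1.
- have dN := Xs_WHb dX; have dH := Xs_Hb dX; have xdN := WHbM xN dN.
  exists (x' * d); split=> //; apply/dstepP => //.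
  right; split; first by rewrite rdescent_Hb.
  by exists d^-1; rewrite ?Xs_inv // (mulgK d).
move=> /(dstepP _ _ xN')[->|[up [d dX ->]]]; apply/coef_cons_neq0.
  by left; rewrite -mulgA refl_sq mulg1.
right; split; first by rewrite rdescent_Hb // (Xs_Hb dX).
by exists d^-1; rewrite ?Xs_inv // (mulgK d).
Qed.

(** Paths are functions on [nat] with letters read by [onth], which keeps the induction free of
    dependent lengths. *)
Lemma coef_path s x : x \in WHb -> coef (rev s) x <> 0%R ->
  exists f : nat -> GL, [/\ f 0 = 1, f (size s) = x, forall k, f k \in WHb
    & forall k i, onth s k = Some i -> dstep i (f k) (f k.+1)].
Proof.
elim/last_ind: s x => [|s i IH] x xN.
  rewrite /=; case: eqP => // -> _; exists (fun=> 1); split=> // [[|k] j] //.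
move=> /(coef_rcons_step _ _ xN)[y [yN /(IH _ yN)[f [f0 fs fN fstep]] yx]].
(* The old path is kept up to [size s] and is constantly [x] afterwards, so all its values stay in
   [WHb]. *)
exists (fun k => if k <= size s then f k else x); split=> //.
- by rewrite size_rcons ltnn.
- by move=> k; case: ifP.
move=> k j; rewrite onthE map_rcons nth_rcons size_map.
case: ltngtP => // [lt_k|->].
  by rewrite -onthE => /fstep.
by case=> <-; rewrite fs.
Qed.

Lemma path_coef s (f : nat -> GL) : f 0 = 1 -> (forall k, k <= size s -> f k \in WHb) ->
  (forall k i, onth s k = Some i -> dstep i (f k) (f k.+1)) ->
  coef (rev s) (f (size s)) <> 0%R.
Proof.
move=> f0; elim/last_ind: s => [|s i IH] fN fstep.
  by rewrite /= f0 eqxx; apply/eqP/oner_neq0.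
rewrite size_rcons in fN *; apply/coef_rcons_step; first exact: fN.
exists (f (size s)); split; first exact/fN/leqnSn.
  apply: IH => [k le_k|k j kj]; first exact/fN/leqW.
  apply: fstep; rewrite onthE map_rcons nth_rcons size_map -onthE kj.
  by case: ltnP => // le; move: kj; rewrite onth_default.
by apply: fstep; rewrite onthE map_rcons nth_rcons size_map ltnn eqxx.
Qed.

End DistinguishedPaths.

(** * Lower sets of the order as end points of distinguished subexpressions *)

Local Open Scope classical_set_scope.

Theorem theorem6p1 (F : finFieldType) (m a b : nat)
    (Ha : (0 < a)%N) (Hb0 : (0 < b)%N) (Hab : coprime a b)
    (Hq : (a * b)%N = (#|F| - 1)%N)
    (Fb : {group {unit F}}) (HFb : #|Fb| = b)
    (p : nat) (s : p.-tuple 'I_m) (Hs : reduced Fb s) :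
  [set x | x \in WHb m Fb /\ rleq Fb x (wprod F s)] =
  [set pi_s xs | xs in [set xs | distinguished Fb s xs]].
Proof.
have /reducedE rs := Hs.
have h1 := Hb1 m Fb.
have onth_s (j : 'I_p) : onth s j = Some (tnth s j).
  by rewrite (tnth_nth (tnth s j)) onthE (nth_map (tnth s j)) // size_tuple.
apply/seteqP; split=> x /=.
  move=> [xN]; rewrite -(mulg1 (wprod F s)) => /(rleqE rs h1 xN).
  rewrite invg1 mulg1 => /(coef_path xN)[f [f0 fs fN fstep]].
  exists [tuple f j | j < p.+1]; last first.
    by rewrite /pi_s tnth_mktuple -[LHS]/(f p) -fs size_tuple.
  split=> [j||j] /=; rewrite ?tnth_mktuple //.
  by have := fstep _ _ (onth_s j).
move=> [xs [xsN xs0 xstep] <-].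
have nth_xs (j : 'I_p.+1) : nth 1 xs j = tnth xs j by rewrite (tnth_nth 1).
split; first exact: xsN.
rewrite -(mulg1 (wprod F s)); apply/(rleqE rs h1 (xsN _)).
rewrite invg1 mulg1 /pi_s -nth_xs -[X in nth _ _ X](size_tuple s).
(* The tuple is read as a function on [nat]; only its entries up to index [p] matter. *)
apply: (path_coef (f := nth 1 xs)).
- by rewrite -[RHS]xs0 -nth_xs.
- by rewrite size_tuple => k le_k; rewrite (nth_xs (Ordinal (le_k : k < p.+1))).
move=> k i ki; have lt_k : k < p.
  by rewrite -(size_tuple s) ltnNge; apply/negP => le; move: ki; rewrite onth_default.
have := xstep (Ordinal lt_k); rewrite -!nth_xs /=.
by have := onth_s (Ordinal lt_k); rewrite /= ki => -[<-].
Qed.
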